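(* Let $E \subset \mathbb{F}_q^d$, where $d \ge 2$ and $|E| > \frac{2k}{\ln 2}\, q^{\frac{d+1}{2}}$. Suppose that $t_i \neq 0$ for $1 \le i \le k$, let $\vec t = (t_1,\dots,t_k)$, and define $$C_k(\vec t) = \left|\left\{(x^1,\dots,x^{k+1}) \in E \times \dots \times E : \|x^i - x^{i+1}\| = t_i,\ 1 \le i \le k\right\}\right|.$$ Then $$C_k(\vec t) = \frac{|E|^{k+1}}{q^k} + \mathcal{D}_k(\vec t), \qquad \text{where} \qquad |\mathcal{D}_k(\vec t)| \le \frac{2k}{\ln 2}\, q^{\frac{d+1}{2}}\, \frac{|E|^k}{q^k}.$$ In particular, since $|E| > \frac{2k}{\ln 2}\, q^{\frac{d+1}{2}}$, $C_k(\vec t) > 0$.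
   Context: $\mathbb{F}_q$ is a finite field with $q$ elements and $\mathbb{F}_q^d$ is the $d$-dimensional vector space over it. $k \ge 1$ is an integer and the $t_i$ are elements of $\mathbb{F}_q$. For $x=(x_1,\dots,x_d) \in \mathbb{F}_q^d$, $\|x\| = x_1^2 + \dots + x_d^2 \in \mathbb{F}_q$. $|S|$ denotes the number of elements of a finite set $S$. The points $x^1,\dots,x^{k+1}$ counted in $C_k(\vec t)$ are not required to be distinct.
   Formalization: The number q of elements of the field is assumed odd; in characteristic 2 the claim fails, e.g. q = 4, d = 5, k = 1, E = {x : x_1+...+x_5 = 0}, where |E| = 256 exceeds the threshold but all ||x-y|| = 0, so C_1(t) = 0. *)

(* Defs.v *)
From HB Require Import structures.
From mathcomp Require Import all_boot all_order all_algebra.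
From mathcomp Require Import reals exp.

Set Implicit Arguments.
Unset Strict Implicit.
Unset Printing Implicit Defensive.

Import Order.TTheory GRing.Theory Num.Theory.
Local Open Scope ring_scope.

(* Takes values in the field: a quadratic form, not a real-valued norm. *)
Definition sqnorm (F : finFieldType) (d : nat) (x : 'rV[F]_d) : F :=
  \sum_(i < d) x 0 i ^+ 2.

(* Indices are shifted to start at 0: x i stands for x^{i+1} and t i for
   t_{i+1}; [lift ord0 i : 'I_k.+1] has value i + 1. *)
Definition chains (F : finFieldType) (d k : nat) (E : {set 'rV[F]_d})
    (t : 'I_k -> F) : {set {ffun 'I_k.+1 -> 'rV[F]_d}} :=
  [set x : {ffun 'I_k.+1 -> 'rV[F]_d} |
    [forall j : 'I_k.+1, x j \in E] &&
    [forall i : 'I_k,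
       sqnorm (x (widen_ord (leqnSn k) i) - x (lift ord0 i)) == t i]].

Definition chain_count (F : finFieldType) (d k : nat) (E : {set 'rV[F]_d})
    (t : 'I_k -> F) : nat := #|chains E t|.

(* Main.v *)
Require Import Defs.
From HB Require Import structures.
From mathcomp Require Import all_boot all_order all_algebra all_field.
From mathcomp Require Import unstable interval_inference.
From mathcomp Require Import reals sequences convex exp.
From mathcomp Require Import complex.
From mathcomp Require Import ring lra zify.

(** Write q for the number of elements of the field and [A_t] for the operator
    on functions on the vector space whose kernel is 1 when ||x - y|| = t and 0
    otherwise.  The theorem is a spectral gap estimate: [A_t] differs from the
    operator with constant kernel 1/q by an operator of norm at most
    [lam] = 2 q^((d-1)/2) ([sphere_discrepancy]).

    Granting this, chains are walks on E, and each step multiplies the function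
    counting them by [A_t] and restricts to E.  With [mu] = |E|/q, induction on
    k gives that the count of walks from x is [mu]^k on E up to an error of
    l2-norm at most sqrt |E| ((mu + lam)^k - mu^k) ([walk_deviation]).  Summing
    over E, the error in C_k is at most |E| mu^k ((1 + lam/mu)^k - 1).  The
    hypothesis on |E| says exactly that k lam/mu < ln 2; on that range
    (1 + x)^k <= exp (k x), and exp lies below its chord from 0 to ln 2, which
    turns the error into the linear bound of the statement.

    The norm of the difference is the largest Fourier coefficient of its
    kernel.  Expanding the sphere in additive characters, that coefficient is
    q^(-1) G^d times a sum over s <> 0 of eta(s)^d psi(a s + b/s), where G is
    the quadratic Gauss sum and eta the quadratic character
    ([fourier_sphere_kernel]).  For odd d this is a Salie sum, evaluated in
    closed form ([salie_eq]).  For even d it is a Kloosterman sum and Weil's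
    bound 2 sqrt q is required ([kloosterman_bound]).

    Weil's bound is proved by the Stepanov-Bombieri method.  Let K_n be the
    Kloosterman sum over the extension of degree n, with the character composed
    with the trace.  Counting quadratic polynomials according to whether they
    split gives K_2 = 2 q - K_1^2 ([kloosterman_double]), so along the tower of
    extensions of degree 2^j the number -K_n follows the recursion
    s -> s^2 - 2 Q, Q being the number of elements of the field at which the
    step starts.  From the first step on it is at least -2 sqrt Q_j, Q_j the
    number of elements of the j-th field, and it grows faster than any constant
    times sqrt Q_j as soon as |K_1| > 2 sqrt q ([power_trace_ge],
    [power_trace_growth]).
    On the other hand, the sum of the K_n over all characters psi(c x), c in
    the base field, is the number of points of the curve
    x + b/x = y^q - y, hence, solving for x, the number of square roots of
    (y^q - y)^2 - 4 b over all y ([sum_kloosterman_tower]).  The genus does not depend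
    on n, and [stepanov] bounds that number from below by Q - O(sqrt Q).
    Positivity of all the other terms then excludes |K_1| > 2 sqrt q. *)

Set Implicit Arguments.
Unset Strict Implicit.
Unset Printing Implicit Defensive.

Import Order.TTheory GRing.Theory Num.Theory.
Local Open Scope ring_scope.

(** * Square roots in finite fields of odd order *)

Lemma sum_nat_of_bool (T : finType) (P : pred T) :
  (\sum_(x : T) (P x : nat) = #|[set x | P x]|)%N.
Proof. by rewrite -sum1dep_card [RHS]big_mkcond; apply: eq_bigr => x _; case: (P x). Qed.

Section OddField.
Variables (F : finFieldType) (hodd : odd #|F|).

Lemma odd_char_neq0 : (2%:R : F) != 0.
Proof.
apply/eqP => h2.
have h2p : 2 \in [pchar F] by rewrite inE /= h2 eqxx.
have := card_pprimeChar h2p; have := finNzRing_gt1 F; move: hodd.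
by case: (logn 2 #|F|) => [|n] ho h1 h; move: ho h1; rewrite h // expnS oddM.
Qed.

Definition half_card := (#|F|.-1)./2.

Lemma card_half : #|F| = half_card.*2.+1.
Proof.
move: hodd (finNzRing_gt1 F); rewrite /half_card; lia.
Qed.

Lemma card_roots_le (p : {poly F}) (A : {set F}) n : p != 0 -> (size p <= n.+1)%N ->
  (forall x, x \in A -> root p x) -> (#|A| <= n)%N.
Proof.
move=> p0 sp hA; rewrite cardE -ltnS; apply: leq_trans sp.
apply: max_poly_roots p0 _ (enum_uniq _).
by apply/allP => x; rewrite mem_enum => /hA.
Qed.

Definition sqroots (v : F) := #|[set y : F | y ^+ 2 == v]|.

Lemma sqroots0 : sqroots 0 = 1%N.
Proof.
by rewrite /sqroots (_ : [set _ | _] = [set 0]) ?cards1 //; apply/setP=> y; rewrite !inE sqrf_eq0.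
Qed.

Lemma sqroots_root (v y : F) : v != 0 -> y ^+ 2 = v -> sqroots v = 2%N.
Proof.
move=> v0 hy; rewrite /sqroots (_ : [set _ | _] = [set y; - y]); last first.
  by apply/setP=> z; rewrite !inE -hy eqf_sqr.
rewrite cards2; have -> // : y != - y.
rewrite -subr_eq0 opprK -mulr2n -mulr_natl mulf_neq0 ?odd_char_neq0 //.
by apply: contra_neq v0 => y0; rewrite -hy y0 expr0n.
Qed.

Lemma expf_half_double (v : F) : v != 0 -> v ^+ half_card.*2 = 1.
Proof.
move=> v0; have := expf_card v.
by rewrite [X in _ ^+ X]card_half exprS -[X in _ = X]mulr1 => /(mulfI v0).
Qed.

Lemma expf_card_half (v : F) : v != 0 -> (v ^+ half_card == 1) || (v ^+ half_card == -1).
Proof.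
move=> v0; rewrite -eqf_sqr expr1n -exprM muln2.
by rewrite expf_half_double.
Qed.

Lemma sum_sqroots : (\sum_(v : F) sqroots v = #|F|)%N.
Proof.
have -> : #|F| = (\sum_(y : F) 1)%N by rewrite sum1_card.
rewrite [RHS](partition_big (fun y : F => y ^+ 2) predT) //=.
apply: eq_bigr => v _. by rewrite sum1dep_card.
Qed.

Lemma card_expf_half : (#|[set v : F | v ^+ half_card == 1%R]| <= half_card)%N.
Proof.
have h0 : (0 < half_card)%N.
  by have := finNzRing_gt1 F; rewrite card_half; case: half_card.
apply: (@card_roots_le ('X^half_card - 1)).
- by rewrite -size_poly_gt0 size_XnsubC.
- by rewrite size_XnsubC.
by move=> x; rewrite inE /root !hornerE subr_eq0.
Qed.

(** Euler's criterion, by counting: each fibre of the squaring map is bounded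
    by the right-hand side, because a square satisfies v^((q-1)/2) = 1, and
    both sides sum to q because 'X^((q-1)/2) - 1 has at most (q-1)/2 roots. *)
Lemma sqroots_half (v : F) : v != 0 -> sqroots v = if v ^+ half_card == 1 then 2%N else 0%N.
Proof.
have hle u : (sqroots u <= (u == 0%R) + 2 * (u ^+ half_card == 1%R))%N.
  have [->|u0] := eqVneq u 0; first by rewrite sqroots0.
  have [h0|/set0Pn [y]] := boolP ([set y : F | y ^+ 2 == u] == set0).
    by rewrite /sqroots (eqP h0) cards0.
  rewrite inE => /eqP hy; rewrite (sqroots_root u0 hy).
  have y0 : y != 0 by apply: contra_neq u0 => y0; rewrite -hy y0 expr0n.
  by rewrite -[X in X ^+ half_card]hy -exprM (mul2n half_card) expf_half_double // eqxx addnC.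
have hsum : (\sum_(u : F) ((u == 0%R) + 2 * (u ^+ half_card == 1%R)) <= #|F|)%N.
  rewrite big_split /= -big_distrr /= !sum_nat_of_bool.
  rewrite (_ : [set _ | _] = [set 0]); last by apply/setP=> x; rewrite !inE.
  by rewrite cards1 [X in (_ <= X)%N]card_half add1n ltnS mul2n leq_double card_expf_half.
move=> v0.
have : sqroots v == ((v == 0%R) + 2 * (v ^+ half_card == 1%R))%N.
  move: hsum; rewrite -sum_sqroots => hsum.
  have h u : true -> (sqroots u <= (u == 0%R) + 2 * (u ^+ half_card == 1%R)
      ?= iff (sqroots u == (u == 0%R) + 2 * (u ^+ half_card == 1%R)))%N by split.
  have [_ ] := leqif_sum (P := predT) (fun u _ => h u isT).
  by rewrite eqn_leq hsum andbT leq_sum // => /esym/forallP/(_ v).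
by move/eqP ->; rewrite (negbTE v0); case: ifP.
Qed.
End OddField.

(** * The Stepanov-Bombieri bound *)

(** Base-'X^P expansion: a bivariate polynomial of degree less than P in the
    inner variable can be recovered from its value at outer variable 'X^P.
    This turns identities in one variable into bivariate ones. *)
Lemma expand_base_inj (K : nzRingType) (P : nat) (phi : {poly {poly K}}) :
  (forall k, (size (phi`_k)%R <= P)%N) -> phi.['X^P] = 0 -> phi = 0.
Proof.
elim/poly_ind: phi => [//|q c IH] hsz.
have hq k : (size (q`_k)%R <= P)%N.
  by have := hsz k.+1; rewrite coefD coefMX coefC addr0.
have hc : (size c <= P)%N by have := hsz 0%N; rewrite coefD coefMX coefC add0r.
rewrite hornerD hornerMX hornerC => h0.
have c0 : c = 0.
  apply/polyP => i; rewrite coef0; have [iP|Pi] := ltnP i P.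
    by have := congr1 (fun p : {poly K} => p`_i) h0; rewrite coefD coefMXn iP add0r coef0.
  by rewrite nth_default // (leq_trans hc).
move: h0; rewrite c0 addr0 => /eqP h0.
suff q0 : q.['X^P] = 0 by rewrite (IH hq q0) mul0r addr0.
apply/polyP => i; have := congr1 (fun p : {poly K} => p`_(i + P)) (eqP h0).
by rewrite coefMXn ltnNge leq_addl addnK !coef0.
Qed.

Lemma size_coefM (K : idomainType) (phi psi : {poly {poly K}}) n n' :
  (forall k, (size (phi`_k)%R <= n.+1)%N) -> (forall k, (size (psi`_k)%R <= n'.+1)%N) ->
  forall k, (size ((phi * psi)`_k)%R <= (n + n').+1)%N.
Proof.
move=> h h' k; rewrite coefM; apply: leq_trans (size_sum _ _ _) _.
apply/bigmax_leqP => i _; apply: leq_trans (size_polyMleq _ _) _.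
by move: (h i) (h' (k - i)%N); case: (size _) => [|?]; case: (size _) => [|?]; lia.
Qed.

Section PowerField.
Variables (L : finFieldType) (P : nat) (hP : #|L| = (P ^ 2)%N).

Lemma card_sqrt_gt0 : (0 < P)%N.
Proof. by have := finNzRing_gt1 L; rewrite hP; case: (P). Qed.

Lemma pchar_card_sqrt (p : nat) : p \in [pchar L] -> p.-nat P.
Proof.
move=> hp; have pp := pcharf_prime hp.
have := card_pprimeChar hp; rewrite hP => h.
have : p.-nat (P ^ 2)%N by rewrite h pnatX pnat_id.
by rewrite pnatX orbF.
Qed.

(** A square root of the number of elements is a power of the characteristic,
    so that x |-> x^P is additive. *)
Lemma exprD_card_sqrt (A : comAlgType L) (x y : A) : (x + y) ^+ P = x ^+ P + y ^+ P.
Proof.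
have [p _ hp] := finPcharP L.
apply: exprDn_pchar; apply: sub_in_pnat (pchar_card_sqrt hp) => // r _.
by rewrite inE => /eqP ->; rewrite (rmorph_pchar (in_alg A)).
Qed.

Lemma sum_exprX_card_sqrt (A : comAlgType L) (I : finType) (g : I -> A) :
  (\sum_i g i) ^+ P = \sum_i g i ^+ P.
Proof.
apply: (big_morph (fun x : A => x ^+ P)) => [x y|]; first exact: exprD_card_sqrt.
by rewrite expr0n eqn0Ngt card_sqrt_gt0.
Qed.

(** Lets the factor f^P be moved to the outer variable of a bivariate identity,
    where it becomes a constant with respect to the inner one. *)
Lemma poly_expP (f : {poly L}) :
  exists2 g : {poly L}, g \Po 'X^P = f ^+ P & size g = size f.
Proof.
elim/poly_ind: f => [|q c [g hg sg]].
  by exists 0; rewrite ?comp_poly0 // expr0n eqn0Ngt card_sqrt_gt0.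
exists (g * 'X + (c ^+ P)%:P).
  rewrite comp_polyD comp_polyM comp_polyX comp_polyC hg.
  by rewrite exprD_card_sqrt exprMn polyC_exp.
rewrite !size_MXaddC sg expf_eq0 card_sqrt_gt0 /=.
by rewrite -!size_poly_eq0 sg.
Qed.
End PowerField.

Lemma coef_sum_monomials (K : nzRingType) n (c : 'I_n -> K) (i : 'I_n) :
  (\sum_(j < n) c j *: 'X^j)`_i = c i.
Proof.
rewrite coef_sum (bigD1 i) //= big1 => [|j ji]; rewrite coefZ coefXn.
  by rewrite eqxx mulr1 addr0.
by rewrite eq_sym (inj_eq val_inj) (negbTE ji) mulr0.
Qed.

(** Comparing leading coefficients in the outer variable, a nonzero solution
    would write a scalar multiple of f as the square of a rational function,
    hence of a polynomial. *)
Lemma twisted_square_eq0 (L : fieldType) (f : {poly L}) (phi psi : {poly {poly L}}) (g : {poly L}) :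
  (forall (c : L) (h : {poly L}), f != c *: h ^+ 2) -> g != 0 ->
  phi ^+ 2 = g^:P * f%:P * psi ^+ 2 -> phi = 0 /\ psi = 0.
Proof.
move=> hf g0 h.
have psi0 : psi = 0.
  apply/eqP/negPn/negP => psi0.
  have hg : lead_coef g^:P = (lead_coef g)%:P by apply: lead_coef_map_inj => //; exact: polyC_inj.
  have := congr1 lead_coef h; rewrite lead_coef_exp lead_coefM lead_coef_exp lead_coefM lead_coefC hg => hl.
  have b0 : lead_coef psi != 0 by rewrite lead_coef_eq0.
  have : (lead_coef psi) ^+ 2 %| (lead_coef phi) ^+ 2 by rewrite hl dvdp_mull.
  rewrite dvdp_pexp2r // => /dvdpP [gam hgam].
  move: hl; rewrite hgam exprMn => /mulIf; rewrite expf_neq0 // => /(_ isT) hl.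
  have lg0 : lead_coef g != 0 by rewrite lead_coef_eq0.
  have /eqP := hf (lead_coef g)^-1 gam; apply.
  by rewrite hl mul_polyC scalerA mulVf // scale1r.
split=> //; move: h; rewrite psi0 expr0n mulr0 => /eqP; by rewrite sqrf_eq0 => /eqP.
Qed.

Section BivariateFamily.
Variables (L : finFieldType) (P a B : nat).

(** The auxiliary polynomial of the Stepanov-Bombieri method is assembled from
    [(bivar u).['X^P]].  Its coefficients are P-th powers so that the P-th power
    of its value at a point of the field, where x^(P^2) = x, is the value of
    [twist u] ([bivar_twist]).  The degree of [twist u] is about aP, whereas [u]
    has aB free coefficients; forcing a combination of two such polynomials to
    vanish is thus a linear system with fewer equations than unknowns. *)
Definition bivar (u : 'M[L]_(a, B)) : {poly {poly L}} :=
  \sum_(k < B) (\sum_(i < a) (u i k ^+ P) *: 'X^i) *: 'X^k.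
Definition twist (u : 'M[L]_(a, B)) : {poly L} :=
  \sum_(k < B) \sum_(i < a) (u i k) *: 'X^(i * P + k).

Lemma coef_bivar u (k : 'I_B) (i : 'I_a) : (bivar u)`_k`_i = u i k ^+ P.
Proof.
by rewrite /bivar !coef_sum_monomials.
Qed.

Lemma size_bivar u (k : nat) : (size ((bivar u)`_k)%R <= a)%N.
Proof.
rewrite /bivar coef_sum; apply: leq_trans (size_sum _ _ _) _.
apply/bigmax_leqP => j _; rewrite coefZ coefXn.
case: eqP => _; last by rewrite mulr0 size_poly0.
rewrite mulr1; apply: leq_trans (size_sum _ _ _) _; apply/bigmax_leqP => i _.
by rewrite (leq_trans (size_scale_leq _ _)) // size_polyXn.
Qed.

Lemma bivar_eq0 u : bivar u = 0 -> u = 0.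
Proof.
move=> h; apply/matrixP => i k; rewrite mxE; have := coef_bivar u k i.
by rewrite h !coef0 => /esym/eqP; rewrite expf_eq0 => /andP [_ /eqP].
Qed.

Lemma bivar_horner u : (bivar u).['X^P] = \sum_(k < B) \sum_(i < a) (u i k ^+ P) *: 'X^(i + k * P).
Proof.
rewrite /bivar horner_sum; apply: eq_bigr => k _.
rewrite hornerZ hornerXn big_distrl; apply: eq_bigr => i _ /=.
by rewrite -scalerAl -exprM -exprD (mulnC P).
Qed.

Lemma size_bivar_horner u : (0 < a)%N -> (0 < B)%N -> (size (bivar u).['X^P] <= a + B.-1 * P)%N.
Proof.
move=> a0 B0; rewrite bivar_horner; apply: leq_trans (size_sum _ _ _) _.
apply/bigmax_leqP => k _; apply: leq_trans (size_sum _ _ _) _.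
apply/bigmax_leqP => i _; rewrite (leq_trans (size_scale_leq _ _)) // size_polyXn.
rewrite -addSn leq_add // leq_mul2r; apply/orP; right; have := ltn_ord k; lia.
Qed.

Lemma size_twist u : (0 < a)%N -> (0 < B)%N -> (size (twist u) <= B + a.-1 * P)%N.
Proof.
move=> a0 B0; apply: leq_trans (size_sum _ _ _) _.
apply/bigmax_leqP => k _; apply: leq_trans (size_sum _ _ _) _.
apply/bigmax_leqP => i _; rewrite (leq_trans (size_scale_leq _ _)) // size_polyXn.
rewrite -addnS addnC leq_add // leq_mul2r; apply/orP; right; have := ltn_ord i; lia.
Qed.

Lemma twistB u v : twist (u - v) = twist u - twist v.
Proof.
rewrite /twist -sumrB; apply: eq_bigr => k _; rewrite -sumrB; apply: eq_bigr => i _.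
by rewrite !mxE scalerBl.
Qed.

Lemma bivar_twist u x : #|L| = (P ^ 2)%N -> (bivar u).['X^P].[x] ^+ P = (twist u).[x].
Proof.
move=> hP; rewrite bivar_horner !horner_sum.
rewrite (@sum_exprX_card_sqrt _ _ hP L^o); apply: eq_bigr => k _.
rewrite !horner_sum (@sum_exprX_card_sqrt _ _ hP L^o); apply: eq_bigr => i _.
rewrite !hornerE exprMn -exprM mulnn -[X in _ ^+ X]hP expf_card; congr (_ * _).
have e : x ^+ (k * P ^ 2) = x ^+ k by rewrite mulnC exprM -hP expf_card.
by rewrite -exprM mulnDl -mulnA mulnn !exprD e.
Qed.

End BivariateFamily.

(** The polynomial U = Phi(u) + f^h Phi(z), with h = (P+1)/2 and Phi(u) the value
    of [bivar u] at 'X^P, vanishes on the whole set once W(u) + e f^h W(z) = 0,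
    with W = [twist]: indeed f(x)^(hP) = f(x)^((Q-1)/2) f(x)^h, which equals
    e f(x)^h on the set.  The coefficients (u, z) outnumber these linear
    conditions, so a nonzero solution exists, and U <> 0 because
    Phi(u)^2 = f^(P+1) Phi(z)^2 would make f a square up to a scalar.  Counting
    the roots of U gives the bound. *)
Lemma stepanov (L : finFieldType) (r m : nat) (f : {poly L}) (e : L) :
  #|L| = (r.*2.+1 ^ 2)%N -> (2 * m <= r)%N -> (size f = (2 * m).+1)%N ->
  (forall (c : L) (g : {poly L}), f != c *: g ^+ 2) ->
  (2 * #|[set x | ((f.[x] == 0) || (f.[x] ^+ half_card L == e))%R]| <=
     r.*2.+1 ^ 2 + 1 + 6 * m * r.*2.+1)%N.
Proof.
move=> hP hm sf hf; set P := r.*2.+1 in hP *; set S := [set x | _].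
(* a is the largest value for which f Phi(z)^2 still has degree less than P in
   the inner variable, as [expand_base_inj] requires; B is then just large
   enough for the unknowns to outnumber the equations *)
pose a := (r.+1 - m)%N; pose B := (r.+1 + 2 * m)%N; pose h := r.+1.
have a0 : (0 < a)%N by rewrite /a; lia.
have B0 : (0 < B)%N by rewrite /B; lia.
pose D := (B + a.-1 * P + 2 * m * h)%N.
pose W (uz : 'M[L]_(a, B) * 'M[L]_(a, B)) := twist P uz.1 + e *: (f ^+ h * twist P uz.2).
have sfh : (size (f ^+ h) <= (2 * m * h).+1)%N.
  by apply: leq_trans (size_poly_exp_leq _ _) _; rewrite sf.
have sW uz : (size (W uz) <= D)%N.
  apply: leq_trans (size_polyD _ _) _; rewrite geq_max; apply/andP; split.
    by apply: leq_trans (size_twist _ _ _ _) _ => //; rewrite leq_addr.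
  apply: leq_trans (size_scale_leq _ _) _; apply: leq_trans (size_polyMleq _ _) _.
  have := size_twist P uz.2 a0 B0; move: sfh; rewrite /D; lia.
have hdim : (D < 2 * (a * B))%N.
  have [s hs] : exists s, r = (2 * m + s)%N by exists (r - 2 * m)%N; rewrite subnKC.
  have -> : a = (m + s).+1 by rewrite /a; lia.
  rewrite /D /B /h /P hs /=; nia.
have [uz [uz0 hW]] : exists uz, uz != (0, 0) /\ W uz = 0.
  have : ~~ injectiveb (fun uz => poly_rV (W uz) : 'rV[L]_D).
    (* pigeonhole on the finite field replaces a dimension count *)
    apply/injectiveP => /leq_card.
    rewrite card_prod !card_mx mul1n -expnD leq_exp2l ?finNzRing_gt1 // leqNgt.
    by move: hdim; rewrite mul2n -addnn => ->.
  case/injectivePn => uz [uz' ne heq]; exists (uz.1 - uz'.1, uz.2 - uz'.2); split.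
    apply: contra_neq ne => -[/subr0_eq h1 /subr0_eq h2].
    by case: (uz) (uz') h1 h2 => [? ?] [? ?] /= -> ->.
  have : W uz = W uz' by rewrite -(poly_rV_K (sW uz)) -(poly_rV_K (sW uz')) heq.
  rewrite /W /= !twistB mulrBr scalerBr => h1.
  by rewrite addrACA -opprD h1 subrr.
case: uz uz0 hW => u z uz0; rewrite /W /= => hW.
pose phi := bivar P u; pose psi := bivar P z.
pose U := phi.['X^P] + f ^+ h * psi.['X^P].
have U0 : U != 0.
  apply: contra_neq uz0; rewrite /U => hU.
  have [g hg sg] := poly_expP hP f.
  have g0 : g != 0 by rewrite -size_poly_gt0 sg sf.
  have /(twisted_square_eq0 hf g0) : phi ^+ 2 = g^:P * f%:P * psi ^+ 2.
    apply/eqP; rewrite -subr_eq0; apply/eqP; apply: (@expand_base_inj _ P).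
      have am : a = a.-1.+1 by rewrite prednK.
      have s2 (v : 'M[L]_(a, B)) k : (size (((bivar P v) ^+ 2)`_k)%R <= (a.-1 + a.-1).+1)%N.
        by apply: size_coefM => j; rewrite -am size_bivar.
      move=> k; rewrite coefB; apply: leq_trans (size_polyD _ _) _.
      rewrite size_polyN geq_max; apply/andP; split.
        by apply: leq_trans (s2 _ _) _; rewrite /a /P; lia.
      have s3 : (size ((g^:P * f%:P * psi ^+ 2)`_k)%R <= (0 + 2 * m + (a.-1 + a.-1)).+1)%N.
        apply: size_coefM; last exact: s2.
        apply: size_coefM => j; first by rewrite coef_map size_polyC; case: eqP.
        by rewrite coefC; case: eqP => _; rewrite ?sf // size_poly0.
      by apply: leq_trans s3 _; rewrite /a /P; lia.
    have eh : (f ^+ h * psi.['X^P]) ^+ 2 = f ^+ P * f * psi.['X^P] ^+ 2.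
      by rewrite exprMn -exprM -exprSr (_ : (h * 2)%N = P.+1) // /h /P; lia.
    rewrite hornerD hornerN !hornerM hornerC -[(g^:P).[_]]/(g \Po 'X^P) hg -!expr2.
    move: hU => /eqP; rewrite addr_eq0 => /eqP ->.
    by rewrite sqrrN eh subrr.
  by case=> /(bivar_eq0) -> /(bivar_eq0) ->.
have sU : (size U <= (a + B.-1 * P + 2 * m * h).-1.+1)%N.
  rewrite prednK ?addn_gt0 ?a0 //.
  have sb := fun v => @size_bivar_horner L P a B v a0 B0.
  apply: leq_trans (size_polyD _ _) _; rewrite geq_max; apply/andP; split.
    by apply: leq_trans (sb _) _; rewrite leq_addr.
  apply: leq_trans (size_polyMleq _ _) _; move: sfh (sb z); rewrite /psi; lia.
have hS : (#|S| <= (a + B.-1 * P + 2 * m * h).-1)%N.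
  apply: card_roots_le U0 sU _ => x; rewrite inE => hx; rewrite /root.
  have P0 : (0 < P)%N by [].
  rewrite -[_ == _]andTb -[X in X && _]P0 -expf_eq0 /U !hornerE.
  rewrite (@exprD_card_sqrt _ _ hP L^o) exprMn !(bivar_twist _ _ hP).
  rewrite -[X in _ == X](horner0 x) -hW !hornerE; apply/eqP; congr (_ + _).
  congr (_ * _); rewrite -exprM /=.
  have -> : (h * P = half_card L + h)%N.
    rewrite /half_card hP (_ : (P ^ 2).-1 = (2 * r * r + 2 * r).*2)%N.
      by rewrite doubleK /h /P -mul2n -addn1; ring.
    rewrite (_ : (P ^ 2 = (2 * r * r + 2 * r).*2.+1)%N) //.
    by rewrite /P -mul2n -[in RHS]mul2n -addn1 -[in RHS]addn1; ring.
  rewrite exprD; case/orP: hx => [/eqP ->|/eqP -> //].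
  by rewrite [0 ^+ h]expr0n /= !mulr0.
have [s hs] : exists s, r = (2 * m + s)%N by exists (r - 2 * m)%N; rewrite subnKC.
have ea : a = (m + s).+1 by rewrite /a; lia.
have eB : B.-1 = (4 * m + s)%N by rewrite /B hs; lia.
have eP : P = (4 * m + 2 * s + 1)%N by rewrite /P hs; lia.
apply: leq_trans (leq_mul (leqnn 2) hS) _.
rewrite ea eB eP /h hs addSn addSn /= -mulnn; lia.
Qed.

(** * Quadratic extensions of finite fields *)

(** Adjoin a square root of a non-square. *)
Lemma quadratic_extension_exists (F : finFieldType) : odd #|F| ->
  exists (L : finFieldType) (iota : {rmorphism F -> L}), #|L| = (#|F| ^ 2)%N.
Proof.
move=> hodd.
have [v v0 hv] : exists2 v : F, v != 0 & sqroots v = 0%N.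
  have : ~~ [forall v : F, (v == 0) || (v ^+ half_card F == 1)].
    apply/negP => /forallP h.
    have h1 := card_expf_half hodd; have h2 := card_half hodd; have h3 := finNzRing_gt1 F.
    have : (#|F| <= #|[set 0%R] :|: [set v : F | v ^+ half_card F == 1%R]|)%N.
      by apply: subset_leq_card; apply/subsetP => x _; rewrite !inE h.
    move/leq_trans/(_ (leq_card_setU _ _)); rewrite cards1 => h4.
    have h5 := leq_trans h4 (leq_add (leqnn 1) h1); move: h3 h5; rewrite h2; case: (half_card F) => // n _ h6; lia.
  rewrite negb_forall => /existsP [v]; rewrite negb_or => /andP [v0 hv].
  by exists v => //; rewrite sqroots_half // (negbTE hv).
pose p : {poly F} := 'X^2 - v%:P.
have sp : size p = 3 by rewrite size_XnsubC.
have mp : p \is monic by apply: monicXnsubC.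
have ip : irreducible_poly p.
  apply: cubic_irreducible => [|x]; first by rewrite sp.
  apply/negP; rewrite /root !hornerE subr_eq0 => hx.
  have : x \in [set y : F | y ^+ 2 == v] by rewrite inE.
  by move: hv; rewrite /sqroots => /eqP; rewrite cards_eq0 => /eqP ->; rewrite inE.
have mi : monic_irreducible_poly p by [].
exists {poly %/ p with mi}, (in_alg {poly %/ p with mi}).
by rewrite card_qfpoly sp.
Qed.

Section QuadraticExtension.
Variables (F L : finFieldType) (iota : {rmorphism F -> L}) (hL : #|L| = (#|F| ^ 2)%N).
Let Q := #|F|.

Lemma conjD (x y : L) : (x + y) ^+ Q = x ^+ Q + y ^+ Q.
Proof. exact: (@exprD_card_sqrt L Q hL L^o). Qed.

Lemma conjK (x : L) : (x ^+ Q) ^+ Q = x.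
Proof. by rewrite -exprM mulnn -hL expf_card. Qed.

Lemma conj_fix (x : F) : iota x ^+ Q = iota x.
Proof. by rewrite -rmorphXn expf_card. Qed.

(** The fixed points of the Frobenius z |-> z^Q are the roots of a polynomial of
    degree Q, and the base field already provides Q of them. *)
Lemma conj_fixP (z : L) : z ^+ Q = z -> exists x, iota x = z.
Proof.
move=> hz; have hQ : (1 < Q)%N := finNzRing_gt1 F.
have p0 : ('X^Q - 'X : {poly L}) != 0.
  by rewrite -size_poly_eq0 size_polyDl size_polyXn // size_polyN size_polyX ltnS.
have sp : (size ('X^Q - 'X : {poly L})%R <= Q.+1)%N.
  by rewrite size_polyDl size_polyXn // size_polyN size_polyX ltnS.
have hle : (#|[set z : L | z ^+ Q == z]| <= Q)%N.
  by apply: (card_roots_le p0 sp) => x; rewrite inE /root !hornerE subr_eq0.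
have hsub : [set iota x | x : F] \subset [set z : L | z ^+ Q == z].
  by apply/subsetP => _ /imsetP [x _ ->]; rewrite inE conj_fix.
have := (subset_leqif_cards hsub).2; rewrite card_imset; last exact: fmorph_inj.
have -> : (#|F| == #|[set z : L | z ^+ Q == z]|).
  rewrite eqn_leq hle andbT; have := subset_leq_card hsub.
  by rewrite card_imset; last exact: fmorph_inj.
move=> /esym/eqP/setP/(_ z); rewrite inE hz eqxx => /imsetP [x _ ->]; by exists x.
Qed.

(** The element of the base field below [z], when [z] comes from there; the
    value is 0 otherwise. *)
Definition descend (z : L) : F := odflt 0 [pick x | iota x == z].

Lemma descendK z : z ^+ Q = z -> iota (descend z) = z.
Proof.
move=> /conj_fixP [x hx]; rewrite /descend; case: pickP => [y /eqP //|/(_ x)].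
by rewrite hx eqxx.
Qed.

Definition qtrace (z : L) : F := descend (z + z ^+ Q).
Definition qnorm (z : L) : F := descend (z * z ^+ Q).

Lemma qtraceE z : iota (qtrace z) = z + z ^+ Q.
Proof. by rewrite descendK // conjD conjK addrC. Qed.

Lemma qnormE z : iota (qnorm z) = z * z ^+ Q.
Proof. by rewrite descendK // exprMn conjK mulrC. Qed.

Lemma qtraceD x y : qtrace (x + y) = qtrace x + qtrace y.
Proof. by apply: (fmorph_inj iota); rewrite rmorphD !qtraceE conjD addrACA. Qed.

Lemma qtrace_exp n z : (forall x y : L, (x + y) ^+ n = x ^+ n + y ^+ n) -> qtrace (z ^+ n) = qtrace z ^+ n.
Proof. by move=> h; apply: (fmorph_inj iota); rewrite rmorphXn !qtraceE h exprAC. Qed.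

Lemma qnorm_eq0 z : (qnorm z == 0) = (z == 0).
Proof.
rewrite -(fmorph_eq0 iota) qnormE mulf_eq0 expf_eq0.
by case: (z == 0); rewrite ?andbF.
Qed.

Hypothesis hodd : odd Q.

Lemma qtrace_iota (c : F) : qtrace (iota c) = 2%:R * c.
Proof. by apply: (fmorph_inj iota); rewrite qtraceE conj_fix rmorphM rmorph_nat; ring. Qed.

Lemma qtrace_inv (b : F) z : z != 0 ->
  qtrace (z + iota b / z) = qtrace z + b * qtrace z / qnorm z.
Proof.
move=> z0; apply: (fmorph_inj iota).
rewrite rmorphD rmorphM fmorphV rmorphM !qtraceE qnormE conjD exprMn conj_fix exprVn.
by have zQ : z ^+ Q != 0 by [rewrite expf_neq0]; field; rewrite z0 zQ.
Qed.

Lemma card_sum_prod (u v : F) :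
  #|[set x : F | x * (u - x) == v]| = sqroots (u ^+ 2 - 4%:R * v).
Proof.
have h2 := odd_char_neq0 hodd.
have inj : injective (fun x : F => 2%:R * x - u) by move=> x y /addIr /(mulfI h2).
rewrite /sqroots -(card_imset _ inj); apply: eq_card => y; rewrite inE.
apply/imsetP/eqP => [[x]|hy].
  by rewrite inE => /eqP <- ->; ring.
exists ((y + u) / 2%:R); last by field.
have -> : v = (u ^+ 2 - y ^+ 2) / 4%:R.
  by rewrite hy; field; rewrite (_ : 4%:R = 2%:R * 2%:R :> F) ?mulf_neq0 // -natrM.
by rewrite inE; apply/eqP; field; rewrite h2 (_ : 4%:R = 2%:R * 2%:R :> F) ?mulf_neq0 // -natrM.
Qed.

(** An element of trace u and norm v is a root of T^2 - u T + v exchanged with the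
    other root by the Frobenius.  There are two if the polynomial is irreducible
    over the base field, one if it has a double root and none if it has two
    distinct roots in the base field: this complements the number of roots in
    the base field to 2.  Completing the square reduces everything to square
    roots w of the discriminant D, for which w^Q = D^((Q-1)/2) w. *)
Lemma card_trace_norm (u v : F) :
  (#|[set z : L | (qtrace z == u) && (qnorm z == v)]| + sqroots (u ^+ 2 - 4%:R * v)%R = 2)%N.
Proof.
have hoddL : odd #|L| by rewrite hL oddX hodd orbT.
have h2 := odd_char_neq0 hoddL.
have h4 : (4%:R : L) != 0 by rewrite (_ : 4%:R = 2%:R * 2%:R :> L) ?mulf_neq0 // -natrM.
set D := u ^+ 2 - 4%:R * v.
have inj : injective (fun z : L => 2%:R * z - iota u) by move=> x y /addIr /(mulfI h2).
have -> : #|[set z : L | (qtrace z == u) && (qnorm z == v)]| =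
  #|[set w : L | (w ^+ Q == - w) && (w ^+ 2 == iota D)]|.
  rewrite -(card_imset _ inj); apply: eq_card => w; rewrite !inE.
  have c2 : (2%:R : L) ^+ Q = 2%:R by have := conj_fix 2%:R; rewrite rmorph_nat.
  have cN (x : L) : (- x) ^+ Q = - x ^+ Q by rewrite exprNn -signr_odd hodd mulN1r.
  have c2V : (2%:R : L)^-1 ^+ Q = 2%:R^-1 by rewrite exprVn c2.
  have iD : iota D = iota u ^+ 2 - 4%:R * iota v by rewrite rmorphB rmorphXn rmorphM rmorph_nat.
  apply/imsetP/andP => [[z]|[/eqP hw1 /eqP hw2]].
    rewrite inE -!(inj_eq (fmorph_inj iota)) qtraceE qnormE => /andP [/eqP h1 /eqP h3] ->.
    rewrite iD conjD cN conj_fix exprMn c2 -h1 -h3.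
    by split; apply/eqP; ring.
  exists ((w + iota u) / 2%:R); last by field.
  rewrite inE -!(inj_eq (fmorph_inj iota)) qtraceE qnormE.
  rewrite exprMn c2V conjD conj_fix hw1.
  have -> : iota v = (iota u ^+ 2 - w ^+ 2) / 4%:R by rewrite hw2 iD; field.
  by apply/andP; split; apply/eqP; field; rewrite ?h2 ?h4.
have [D0|D0] := eqVneq D 0.
  rewrite D0 rmorph0 sqroots0 (_ : [set _ | _] = [set 0]) ?cards1 //.
  apply/setP=> w; rewrite !inE sqrf_eq0; case: (eqVneq w 0) => [->|]; rewrite ?andbF ?andbT //.
  by rewrite expr0n oppr0 /Q; case: #|F| (finNzRing_gt1 F) => [|?]; rewrite ?eqxx.
have iD0 : iota D != 0 by rewrite fmorph_eq0.
rewrite sqroots_half //.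
have hc (w : L) : w ^+ 2 = iota D -> w ^+ Q = iota (D ^+ half_card F) * w.
  by move=> hw; rewrite {1}/Q (card_half hodd) exprSr -mul2n exprM hw rmorphXn.
have w0 (w : L) : w ^+ 2 = iota D -> w != 0.
  by move=> hw; apply: contra_neq iD0 => w0; rewrite -hw w0 expr0n.
case: ifP => [/eqP hD|hD].
  rewrite (_ : [set _ | _] = set0) ?cards0 //; apply/setP=> w; rewrite !inE.
  apply/negP => /andP [/eqP hw1 /eqP hw2].
  move: hw1; rewrite (hc _ hw2) hD rmorph1 mul1r => /eqP.
  rewrite -subr_eq0 opprK -mulr2n -mulr_natl mulf_eq0 (negbTE h2) /=.
  by rewrite (negbTE (w0 _ hw2)).
have hD' : D ^+ half_card F = -1.
  by case/orP: (expf_card_half hodd D0) => /eqP // h; rewrite h eqxx in hD.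
rewrite addn0 -[RHS](_ : sqroots (iota D) = 2%N).
  apply: eq_card => w; rewrite !inE; case: (w ^+ 2 =P iota D) => hw; rewrite ?andbF //.
  by rewrite (hc _ hw) hD' rmorphN1 mulN1r eqxx.
rewrite sqroots_half // (_ : half_card L = half_card F * Q.+1)%N.
  by rewrite exprM -rmorphXn hD' rmorphN1 -signr_odd /= hodd expr0 eqxx.
have := card_half hoddL; have := card_half hodd; rewrite hL -/Q => hq hq2.
move: hq2; rewrite hq; nia.
Qed.
End QuadraticExtension.

(** * Additive characters and Kloosterman sums *)

Definition add_char (C : numClosedFieldType) (F : finFieldType) (psi : F -> C) :=
  psi 0 = 1 /\ (forall x y, psi (x + y) = psi x * psi y).

Definition nontrivial_char (C : numClosedFieldType) (F : finFieldType) (psi : F -> C) :=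
  add_char psi /\ exists x, psi x != 1.

Section Chars.
Variables (C : numClosedFieldType) (F : finFieldType).

(** A root of 1 + X + ... + X^(p-1), which is not 1 in characteristic 0. *)
Lemma prime_root_of_unity p : prime p -> exists2 z : C, z != 1 & z ^+ p = 1.
Proof.
move=> pp; have p1 := prime_gt1 pp.
pose q : {poly C} := \sum_(i < p) 'X^i.
have hq : 'X^p - 1 = ('X - 1) * q by exact: subrX1.
have sq : size q != 1.
  have := congr1 (fun r : {poly C} => size r) hq; rewrite size_XnsubC ?prime_gt0 //.
  have q0 : q != 0.
    by apply/eqP => q0; move/eqP: hq; rewrite q0 mulr0 -size_poly_eq0 size_XnsubC ?prime_gt0.
  rewrite -polyC1 size_mul ?polyXsubC_eq0 // size_XsubC addSn add1n /= => -[<-].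
  by case: (p) p1 => [|[]].
have [z hz] := closed_rootP q sq; exists z.
  apply/eqP => z1; move: hz; rewrite z1 /root /q horner_sum.
  under eq_bigr do rewrite hornerXn expr1n.
  by rewrite sumr_const card_ord pnatr_eq0 eqn0Ngt prime_gt0.
have := congr1 (fun r : {poly C} => r.[z]) hq; rewrite hornerM (eqP hz) mulr0 !hornerE.
by move/eqP; rewrite subr_eq0 => /eqP.
Qed.

(** Compose a nonzero coordinate of the field, as a vector space over its prime
    field, with the powers of a nontrivial p-th root of unity. *)
Lemma nontrivial_char_exists : exists psi : F -> C, nontrivial_char psi.
Proof.
have [p pp hp] := finPcharP F.
have [z z1 hz] := prime_root_of_unity pp.
have [v2r v2rlin [r2v r2vK v2rK]] := pprimeChar_vectAxiom hp.
have n0 : (0 < logn p #|F|)%N.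
  by have := card_pprimeChar hp; case: (logn p _) => // h; have := finNzRing_gt1 F; rewrite h.
pose i0 : 'I_(logn p #|F|) := Ordinal n0.
have v2rD (x y : F) : v2r (x + y) = v2r x + v2r y.
  by have := v2rlin 1 x y; rewrite !scale1r.
have v2r0 : v2r (0 : F) = 0 by apply: (addIr (v2r 0)); rewrite -v2rD !add0r.
have hz' : z ^+ (Zp_trunc (pdiv p)).+2 = 1 by rewrite Fp_cast.
exists (fun x : F => z ^+ (v2r x 0 i0 : 'F_p)); split; first split=> [|x y].
- by rewrite v2r0 mxE.
- by rewrite v2rD mxE /= -exprD; rewrite (expr_mod _ hz').
exists (r2v (delta_mx 0 i0)).
by rewrite v2rK mxE !eqxx /= modn_small ?expr1 // Fp_cast // prime_gt1.
Qed.

Variables (psi : F -> C) (hpsi : add_char psi).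

Lemma char0 : psi 0 = 1. Proof. by case: hpsi. Qed.
Lemma charD x y : psi (x + y) = psi x * psi y. Proof. by case: hpsi. Qed.

Lemma charMn x n : psi (x *+ n) = psi x ^+ n.
Proof. by elim: n => [|n IH]; rewrite ?char0 // mulrS charD IH exprS. Qed.

Lemma norm_char x : `|psi x| = 1.
Proof.
have [p pp hp] := finPcharP F; apply/eqP.
rewrite -(@pexpr_eq1 _ _ p) ?normr_ge0 ?prime_gt0 // -normrX -charMn.
by rewrite -mulr_natr (pcharf0 hp) mulr0 char0 normr1.
Qed.

Lemma char_neq0 x : psi x != 0.
Proof. by rewrite -normr_eq0 norm_char oner_neq0. Qed.

Lemma charN x : psi (- x) = (psi x)^*.
Proof.
apply: (mulfI (char_neq0 x)).
by rewrite -charD subrr char0 -normCK norm_char expr1n.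
Qed.

Lemma char_scale a : add_char (fun x => psi (a * x)).
Proof. by split=> [|x y]; rewrite ?mulr0 ?char0 // mulrDr charD. Qed.

Lemma char_sum (I : Type) (r : seq I) (P : pred I) (g : I -> F) :
  psi (\sum_(i <- r | P i) g i) = \prod_(i <- r | P i) psi (g i).
Proof. by apply: (big_morph psi) => [x y|]; rewrite ?charD ?char0. Qed.

Hypothesis hnt : exists x, psi x != 1.

Lemma sum_char : \sum_x psi x = 0.
Proof.
have [a ha] := hnt; apply/eqP.
have h : (psi a - 1) * \sum_x psi x = 0.
  rewrite mulrBl mul1r mulr_sumr [X in _ - X](reindex_inj (addrI a)) /=.
  by apply/eqP; rewrite subr_eq0; apply/eqP; apply: eq_bigr => x _; rewrite charD.
by move/eqP: h; rewrite mulf_eq0 subr_eq0 (negbTE ha).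
Qed.

Lemma sum_char_scale a : \sum_x psi (a * x) = if a == 0 then #|F|%:R else 0.
Proof.
case: eqP => [->|/eqP a0].
  by under eq_bigr do rewrite mul0r char0; rewrite sumr_const.
by have := sum_char; rewrite (reindex_inj (mulfI a0)).
Qed.

End Chars.

Section Kloosterman.
Variables (C : numClosedFieldType).

Definition kloosterman (F : finFieldType) (psi : F -> C) (b : F) : C :=
  \sum_(x | x != 0) psi (x + b / x).

Lemma kloosterman_real (F : finFieldType) (psi : F -> C) b : add_char psi -> kloosterman psi b \is Num.real.
Proof.
move=> hpsi; apply/CrealP; rewrite rmorph_sum /kloosterman (reindex_inj oppr_inj) /=.
apply: eq_big => [x|x x0]; first by rewrite oppr_eq0.
by rewrite -charN // invrN mulrN opprD !opprK.
Qed.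

Lemma sum_by_trace_norm (F : finFieldType) (T : finType) (t n : T -> F) (g : F -> F -> C) :
  \sum_(x | n x != 0) g (t x) (n x) =
  \sum_(v | v != 0) \sum_u g u v *+ #|[set x | (t x == u) && (n x == v)]|.
Proof.
rewrite (partition_big n (fun v => v != 0)) //=; apply: eq_bigr => v v0.
rewrite (partition_big t predT) //=; apply: eq_bigr => u _.
rewrite -sumr_const; apply: eq_big => [x|x]; rewrite ?inE.
  by case: (n x =P v) => [->|]; rewrite ?v0 ?andbF //= andbT.
by case/andP => /andP [_ /eqP ->] /eqP ->.
Qed.

Lemma card_sum_prod2 (F : finFieldType) (u v : F) :
  #|[set xy : F * F | (xy.1 + xy.2 == u) && (xy.1 * xy.2 == v)]| = #|[set x : F | x * (u - x) == v]|.
Proof.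
have inj : injective (fun x : F => (x, u - x)) by move=> x y [].
rewrite -[RHS](card_imset _ inj); apply: eq_card => -[x y]; rewrite inE /=.
apply/andP/imsetP => [[/eqP <- /eqP <-]|[z]].
  by exists x; rewrite ?inE addrAC subrr add0r.
by rewrite inE => /eqP <- [-> ->]; rewrite subrKC !eqxx.
Qed.

(** Both the sum over the extension and the square of the sum over the base field
    are sums of psi (u + b u/v), the former over elements of trace u and norm v,
    the latter over pairs of sum u and product v.  Together every (u, v) is taken
    twice ([card_trace_norm]), and the resulting complete sum over u is nonzero
    only for v = - b. *)
Lemma kloosterman_double (F L : finFieldType) (iota : {rmorphism F -> L})
    (psi : F -> C) (b : F) : #|L| = (#|F| ^ 2)%N -> odd #|F| -> nontrivial_char psi -> b != 0 ->
  kloosterman (psi \o qtrace iota) (iota b) = 2%:R * #|F|%:R - kloosterman psi b ^+ 2.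
Proof.
move=> hL hodd [hpsi hnt] b0.
pose g u v := psi (u + b * u / v).
have h1 : kloosterman (psi \o qtrace iota) (iota b) =
  \sum_(z | qnorm iota z != 0) g (qtrace iota z) (qnorm iota z).
  apply: eq_big => z; first by rewrite (qnorm_eq0 iota hL).
  by move=> z0; rewrite /= qtrace_inv.
have h2 : kloosterman psi b ^+ 2 = \sum_(xy : F * F | xy.1 * xy.2 != 0) g (xy.1 + xy.2) (xy.1 * xy.2).
  rewrite expr2 /kloosterman mulr_suml; under eq_bigr do rewrite mulr_sumr.
  rewrite pair_big /=; apply: eq_big => [xy|xy]; first by rewrite mulf_eq0 negb_or.
  by case/andP=> x0 y0; rewrite -charD // /g; congr psi; field; rewrite x0 y0.
rewrite h1 sum_by_trace_norm; apply/eqP; rewrite eq_sym subr_eq; apply/eqP.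
rewrite h2 (sum_by_trace_norm (fun xy : F * F => xy.1 + xy.2) (fun xy => xy.1 * xy.2) g).
rewrite -big_split /=.
transitivity (\sum_(v : F | v != 0) 2%:R * \sum_u psi ((1 + b / v) * u)); last first.
  apply: eq_bigr => v v0; rewrite -big_split /= mulr_sumr; apply: eq_bigr => u _.
  rewrite -mulrnDr card_sum_prod2 (card_sum_prod hodd) (card_trace_norm iota hL hodd).
  by rewrite mulr_natl /g; congr (psi _ *+ _); field.
under eq_bigr do rewrite (sum_char_scale hpsi hnt).
rewrite (bigD1 (- b)) ?oppr_eq0 //= big1 ?addr0 => [|v /andP [v0 vb]].
  by rewrite invrN mulrN divff // subrr eqxx.
case: eqP => h; last by rewrite mulr0.
have e : v + b = v * (1 + b / v) by field.
by case/eqP: vb; apply/eqP; rewrite -addr_eq0 e h mulr0.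
Qed.
End Kloosterman.

(** * Weil's bound for Kloosterman sums *)

(** If s = al + be and al be = q, this is al^(2^j) + be^(2^j). *)
Fixpoint power_trace (A : nzRingType) (q : nat) (s : A) (j : nat) : A :=
  if j is j'.+1 then power_trace q s j' ^+ 2 - (2 * q ^ (2 ^ j'))%:R else s.

Lemma rmorph_power_trace (A B : nzRingType) (h : {rmorphism A -> B}) q s j :
  power_trace q (h s) j = h (power_trace q s j).
Proof. by elim: j => //= j ->; rewrite rmorphB rmorphXn rmorph_nat. Qed.

Lemma exprD_card_base (F L : finFieldType) (iota : {rmorphism F -> L}) (x y : L) :
  (x + y) ^+ #|F| = x ^+ #|F| + y ^+ #|F|.
Proof.
have [p pp hp] := finPcharP F; have := card_pprimeChar hp => hc.
apply: exprDn_pchar; rewrite [X in _.-nat X]hc pnatX.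
by apply/orP; left; rewrite pnatE // (fmorph_pchar iota).
Qed.

Lemma natr_card_base (F L : finFieldType) (iota : {rmorphism F -> L}) : (#|F|%:R : L) = 0.
Proof.
have [p pp hp] := finPcharP F; have hc := card_pprimeChar hp.
rewrite -(rmorph_nat iota) [X in iota X%:R]hc natrX (pcharf0 hp) expr0n.
case: eqP => [h|_]; last by rewrite rmorph0.
by have := finNzRing_gt1 F; rewrite [X in (1 < X)%N]hc h.
Qed.

(** [L] is an extension of degree 2^j of [F], with [tau] standing for the trace;
    only the listed properties of the trace are used, which makes the tower
    easy to build one quadratic step at a time. *)
Record tower_level (C : numClosedFieldType) (F L : finFieldType)
    (iota : {rmorphism F -> L}) (tau : L -> F) (j : nat) : Prop := TowerLevel {
  tower_card : #|L| = (#|F| ^ (2 ^ j))%N;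
  towerD : forall x y, tau (x + y) = tau x + tau y;
  tower_surj : forall c, exists z, tau z = c;
  tower_frob : forall z, tau (z ^+ #|F|) = tau z;
  tower_kloosterman : forall (psi : F -> C) b, nontrivial_char psi -> b != 0 ->
    kloosterman (psi \o tau) (iota b) = - power_trace #|F| (- kloosterman psi b) j }.

Lemma tower_exists (C : numClosedFieldType) (F : finFieldType) (j : nat) : odd #|F| ->
  exists (L : finFieldType) (iota : {rmorphism F -> L}) (tau : L -> F), tower_level C iota tau j.
Proof.
move=> hodd; elim: j => [|j [L [iota [tau [hc hD hs hf hk]]]]].
  exists F, idfun, idfun; split => //= [c|z|psi b _ _].
  - by exists c.
  - by rewrite expf_card.
  by rewrite opprK.
have hoddL : odd #|L| by rewrite hc oddX hodd orbT.
have [M [kap hM]] := quadratic_extension_exists hoddL.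
have tau0 : tau 0 = 0 by apply: (addIr (tau 0)); rewrite -hD !add0r.
exists M, (kap \o iota), (tau \o qtrace kap); split.
- by rewrite hM hc -expnM expnS mulnC.
- by move=> x y; rewrite /= (qtraceD kap hM) hD.
- move=> c; have [z hz] := hs c; exists (kap (z / 2%:R)).
  by rewrite /= (qtrace_iota kap hM) mulrC divfK // odd_char_neq0.
- move=> z; rewrite /= (qtrace_exp kap hM) ?hf //; exact: (exprD_card_base (kap \o iota)).
move=> psi b [hpsi [a ha]] b0.
have hnt : nontrivial_char (psi \o tau).
  split; first by split=> [|x y] /=; rewrite ?tau0 ?char0 // hD charD.
  by have [z hz] := hs a; exists z; rewrite /= hz.
have ib0 : iota b != 0 by rewrite fmorph_eq0.
have := kloosterman_double kap hM hoddL hnt ib0.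
rewrite (hk psi b (conj hpsi (ex_intro _ a ha)) b0) sqrrN => h; rewrite [LHS]h hc /=.
by rewrite opprB natrM.
Qed.

Section CountLevel.
Variables (C : numClosedFieldType) (F L : finFieldType).
Variables (iota : {rmorphism F -> L}) (tau : L -> F) (j : nat).
Hypothesis htow : tower_level C iota tau j.
Hypothesis hodd : odd #|F|.
Let q := #|F|.
Variables (psi : F -> C) (hpsi : nontrivial_char psi).

Lemma tower0 : tau 0 = 0.
Proof. by apply: (addIr (tau 0)); rewrite -(towerD htow) !add0r. Qed.

Lemma towerB x y : tau (x - y) = tau x - tau y.
Proof. by apply: (addIr (tau y)); rewrite -(towerD htow) !subrK. Qed.

Lemma sum_char_tower (x : L) : \sum_c psi (c * tau x) = if tau x == 0 then q%:R else 0.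
Proof.
by under eq_bigr do rewrite mulrC; rewrite sum_char_scale //; case: hpsi.
Qed.

Lemma card_tower_ker : (q * #|[set x | tau x == 0%R]| = #|L|)%N.
Proof.
apply/eqP; rewrite -(eqr_nat C); apply/eqP.
transitivity (\sum_x \sum_c psi (c * tau x)).
  under [RHS]eq_bigr do rewrite sum_char_tower.
  rewrite -big_mkcond /= sumr_const natrM -[RHS]mulr_natr; congr (_ * _%:R).
  by apply: eq_card => x; rewrite !inE.
rewrite exchange_big /= (bigD1 0) //= [X in _ + X]big1 ?addr0 => [|c c0].
  by under eq_bigr do rewrite mul0r (char0 (proj1 hpsi)); rewrite sumr_const.
apply: (@sum_char C L (fun x => psi (c * tau x))).
  have h := char_scale (proj1 hpsi) c.
  by split=> [|x y]; rewrite ?tower0 ?(char0 h) // (towerD htow) (charD h).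
have [a ha] := proj2 hpsi; have [z hz] := tower_surj htow (a / c).
by exists z; rewrite hz mulrC divfK.
Qed.

(** Additive Hilbert 90.  A fibre of y |-> y^q - y has at most q points, and none
    above an element of nonzero trace; both sides have the same sum over x, so
    equality holds throughout. *)
Lemma card_artin_schreier (x : L) :
  #|[set y : L | y ^+ q - y == x]| = if tau x == 0 then q else 0%N.
Proof.
pose n x := #|[set y : L | y ^+ q - y == x]|.
have hle u : (n u <= q * (tau u == 0%R))%N.
  case: eqP => hu; rewrite ?muln1 ?muln0.
    have sq : size ('X^q - 'X - u%:P) = q.+1.
      have q1 : (1 < q)%N := finNzRing_gt1 F.
      rewrite -addrA size_polyDl size_polyXn // -opprD size_polyN.
      apply: leq_ltn_trans (size_polyD _ _) _; rewrite size_polyX gtn_max !ltnS q1.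
      by apply: leq_trans (size_polyC_leq1 _) (ltnW q1).
    have p0 : 'X^q - 'X - u%:P != 0 by rewrite -size_poly_gt0 sq.
    apply: card_roots_le p0 _ _ => [|y]; first by rewrite sq.
    by rewrite inE /root !hornerE subr_eq0.
  rewrite leqn0 cards_eq0; apply/eqP/setP => y; rewrite !inE; apply/negP => /eqP hy.
  by apply: hu; rewrite -hy towerB (tower_frob htow) subrr.
have hsum : (\sum_u n u = \sum_(u : L) q * (tau u == 0%R))%N.
  rewrite -big_distrr /= sum_nat_of_bool card_tower_ker.
  have -> : #|L| = (\sum_(y : L) 1)%N by rewrite sum1_card.
  rewrite [RHS](partition_big (fun y : L => y ^+ q - y) predT) //=.
  by apply: eq_bigr => v _; rewrite sum1dep_card.
have h u : true -> (n u <= q * (tau u == 0%R) ?= iff (n u == q * (tau u == 0%R)))%N by split.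
have [_ ] := leqif_sum (P := predT) (fun u _ => h u isT).
rewrite hsum eqxx => /esym/forallP/(_ x)/eqP; rewrite /n => ->.
by case: eqP => _; rewrite ?muln1 ?muln0.
Qed.

(** Summing over c detects the x such that x + b/x has trace zero, that is, of
    the form y^q - y, and each of them is so in q ways.  For a given y the
    equation in x is quadratic, with discriminant (y^q - y)^2 - 4 b. *)
Lemma sum_kloosterman_tower (b : L) : b != 0 ->
  \sum_c kloosterman (fun x => psi (c * tau x)) b =
    (\sum_(y : L) sqroots ((y ^+ q - y) ^+ 2 - 4%:R * b)%R)%:R.
Proof.
move=> b0; have hoddL : odd #|L| by rewrite (tower_card htow) oddX hodd orbT.
rewrite exchange_big /=; under eq_bigr do rewrite sum_char_tower.
have -> : \sum_(x : L | x != 0) (if tau (x + b / x) == 0 then q%:R else 0) =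
   (\sum_(x : L | x != 0%R) \sum_(y : L) (y ^+ q - y == x + b / x)%R)%:R :> C.
  rewrite natr_sum; apply: eq_bigr => x x0.
  by rewrite sum_nat_of_bool card_artin_schreier; case: eqP.
rewrite exchange_big /=; congr (_%:R); apply: eq_bigr => y _.
rewrite -(card_sum_prod hoddL) -sum1dep_card big_mkcond [RHS]big_mkcond /=.
apply: eq_bigr => x _; have [->|x0] /= := eqVneq x 0.
  by rewrite mul0r eq_sym (negbTE b0).
have -> : (y ^+ q - y == x + b / x) = (x * (y ^+ q - y - x) == b).
  apply/eqP/eqP => [->|<-]; first by field.
  by rewrite mulrC mulKf // subrKC.
by case: eqP.
Qed.
End CountLevel.

Lemma size_XqsubX (L : nzRingType) (q : nat) : (1 < q)%N -> size ('X^q - 'X : {poly L}) = q.+1.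
Proof. by move=> q1; rewrite size_polyDl size_polyXn // size_polyN size_polyX. Qed.

Lemma size_artin_schreier_disc (L : idomainType) (q : nat) (b : L) : (1 < q)%N ->
  size (('X^q - 'X) ^+ 2 - b%:P) = (2 * q).+1.
Proof.
move=> q1; have sU2 : size (('X^q - 'X : {poly L}) ^+ 2) = (2 * q).+1.
  rewrite -[LHS]prednK ?size_exp ?size_XqsubX //= ?(mulnC 2) //.
  by rewrite size_poly_gt0 expf_neq0 // -size_poly_gt0 size_XqsubX.
rewrite size_polyDl sU2 // size_polyN; apply: leq_ltn_trans (size_polyC_leq1 _) _; lia.
Qed.

(** The derivative of U^2 - b, with U = 'X^q - 'X, is - 2 U; a square factor g^2
    would have g dividing both U and U^2 - b, hence the constant b. *)
Lemma artin_schreier_not_square (L : finFieldType) (q : nat) (b : L) : odd #|L| ->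
  (q%:R : L) = 0 -> (1 < q)%N -> b != 0 ->
  forall (c : L) (g : {poly L}), ('X^q - 'X) ^+ 2 - b%:P != c *: g ^+ 2.
Proof.
move=> hodd hq q1 b0 c g; apply/eqP => h.
have sf := size_artin_schreier_disc b q1.
set U : {poly L} := 'X^q - 'X in h sf.
have dU : U^`() = -1 by rewrite derivB derivXn derivX -mulr_natl -polyC_natr hq mul0r sub0r.
have gf : g %| U ^+ 2 - b%:P by rewrite h -mul_polyC expr2 mulrA dvdp_mull.
have gU : g %| U.
  have := congr1 (fun r : {poly L} => r^`()) h.
  rewrite derivB derivC subr0 derivZ !deriv_exp /= dU !expr1 -mul_polyC => hd.
  have e : U *+ 2 = (- (c%:P * g^`() *+ 2)) * g.
    by rewrite -[LHS]opprK -mulNrn -[- U]mulN1r hd; ring.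
  have : g %| U *+ 2 by rewrite e dvdp_mull.
  by rewrite -scaler_nat dvdpZr // odd_char_neq0.
have g1 : g %| 1.
  have : g %| b%:P by rewrite -(subKr (U ^+ 2) b%:P) dvdp_sub // dvdp_exp.
  by rewrite -alg_polyC dvdpZr.
move: g1; rewrite dvdp1 => /eqP sg.
have : (size (c *: g ^+ 2) <= 1)%N.
  by apply: leq_trans (size_scale_leq _ _) _; apply: leq_trans (size_poly_exp_leq _ _) _; rewrite sg.
by rewrite -h sf; case: (q) q1.
Qed.

(** [stepanov] with e = -1 bounds the number of y at which the discriminant is
    zero or a non-square; at every other y it has two square roots. *)
Lemma sum_sqroots_lower (L : finFieldType) (r q : nat) (b : L) :
  #|L| = (r.*2.+1 ^ 2)%N -> (2 * q <= r)%N -> (q%:R : L) = 0 -> (1 < q)%N -> b != 0 ->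
  (#|L| <= (\sum_(y : L) sqroots ((y ^+ q - y) ^+ 2 - b)%R) + 1 + 6 * q * r.*2.+1)%N.
Proof.
move=> hL hr hq q1 b0.
have hodd : odd #|L| by rewrite hL oddX /= odd_double.
set f := ('X^q - 'X) ^+ 2 - b%:P.
have sf : size f = (2 * q).+1 := size_artin_schreier_disc b q1.
have := stepanov (-1) hL hr sf (artin_schreier_not_square hodd hq q1 b0).
set S := [set x | _] => hS.
have hf y : f.[y] = (y ^+ q - y) ^+ 2 - b by rewrite /f !hornerE.
have : (2 * #|~: S| <= \sum_(y : L) sqroots ((y ^+ q - y) ^+ 2 - b)%R)%N.
  rewrite -sum1_card big_distrr /= big_mkcond /=; apply: leq_sum => y _.
  case: ifP => //; rewrite !inE hf negb_or => /andP [h0 h1].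
  rewrite sqroots_half //.
  by case/orP: (expf_card_half hodd h0) h1 => ->.
have := cardsC S; rewrite hL; move: hS; nia.
Qed.

Lemma power_trace_ge (R : realDomainType) (q : nat) (s : R) j :
  - (2 * q ^ (2 ^ j))%:R <= power_trace q s j.+1.
Proof. by rewrite /= -[leLHS]add0r lerD2r sqr_ge0. Qed.

(** In terms of the normalised quantity 2 + x, one step is
    (2 + x)^2 - 2 >= 2 + 4 x. *)
Lemma power_trace_growth (R : realDomainType) (q : nat) (s d : R) j : 0 <= d ->
  (2%:R + d) * q%:R <= s ^+ 2 - (2 * q)%:R ->
  (2%:R + 4%:R ^+ j * d) * (q ^ (2 ^ j))%:R <= power_trace q s j.+1.
Proof.
move=> d0 h; elim: j => [|j IH]; first by rewrite /= expr0 mul1r expn0 expn1.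
rewrite [power_trace _ _ _]/= -/(power_trace q s j.+1).
set P : R := (q ^ (2 ^ j))%:R in IH *.
have -> : ((q ^ (2 ^ j.+1))%:R : R) = P ^+ 2 by rewrite /P -natrX -expnM expnSr.
rewrite natrM (_ : ((q ^ (2 ^ j.+1))%:R : R) = P ^+ 2); last by rewrite /P -natrX -expnM expnSr.
have P0 : 0 <= P by rewrite ler0n.
set x := 4%:R ^+ j * d in IH.
have x0 : 0 <= x by rewrite mulr_ge0 // exprn_ge0 // ler0n.
have -> : 4%:R ^+ j.+1 * d = 4%:R * x by rewrite exprS mulrA.
have h2 : ((2%:R + x) * P) ^+ 2 <= power_trace q s j.+1 ^+ 2.
  by rewrite lerXn2r // nnegrE ?(le_trans _ IH) // mulr_ge0 // addr_ge0 // ler0n.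
have : 0 <= (x * P) ^+ 2 by rewrite sqr_ge0.
move: h2; set t := power_trace _ _ _; nra.
Qed.

Lemma archi_pow4 (R : realType) (d M : R) : 0 < d -> exists2 j, (2 <= j)%N & M < 4%:R ^+ j * d.
Proof.
move=> d0; exists (Num.bound `|M / d|).+2 => //.
rewrite -ltr_pdivrMr //; apply: le_lt_trans (ler_norm _) _.
apply: lt_le_trans (archi_boundP (normr_ge0 _)) _.
rewrite -natrX ler_nat; set n := Num.bound _.
by apply: leq_trans (ltnW (ltn_expl n (isT : 1 < 4)%N)) _; rewrite leq_exp2l // -addn2 leq_addr.
Qed.

Lemma card_nonzero (K : finFieldType) : #|[pred x : K | x != 0]|.+1 = #|K|.
Proof.
rewrite [RHS](cardD1 (0 : K)) inE add1n; congr S.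
by apply: eq_card => x; rewrite !inE andbT.
Qed.

Section Weil.
Variable R : realType.
Local Notation C := R[i].
Local Open Scope complex_scope.

(** Weil's bound.  In the field with P^2 = q^(2^(j+1)) elements, the sum over
    c <> 0 of the negated Kloosterman sums [s c] is at most 6 q P by
    [sum_sqroots_lower].  Since each [s c] + 2 P is nonnegative, [s 1] + 2 P alone
    is at most 8 q P.  If the bound failed, [s 1] would be at least (2 + 4^j d) P
    for a fixed d > 0. *)
Lemma kloosterman_bound (F : finFieldType) (psi : F -> C) (b : F) : odd #|F| ->
  nontrivial_char psi -> b != 0 -> kloosterman psi b ^+ 2 <= (4 * #|F|)%:R.
Proof.
move=> hodd hpsi b0; set q := #|F|; have q1 : (1 < q)%N := finNzRing_gt1 F.
pose psic c := fun x : F => psi (c * x).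
have hpsic c : c != 0 -> nontrivial_char (psic c).
  move=> c0; split; first exact: char_scale (proj1 hpsi) c.
  by have [a ha] := proj2 hpsi; exists (a / c); rewrite /psic mulrC divfK.
pose k c : R := complex.Re (kloosterman (psic c) b).
have hk c : c != 0 -> kloosterman (psic c) b = (k c)%:C.
  by move=> c0; rewrite RRe_real // kloosterman_real //; case: (hpsic c c0).
have psi1 : kloosterman psi b = (k 1)%:C.
  by rewrite -hk ?oner_neq0 //; apply: eq_bigr => x _; rewrite /psic mul1r.
rewrite psi1 -rmorphXn -(rmorph_nat (real_complex R)) lecR.
rewrite leNgt; apply/negP => hbad.
have q0 : 0 < (q%:R : R) by rewrite ltr0n ltnW.
pose d := ((k 1) ^+ 2 - (4 * q)%:R) / q%:R.
have d0 : 0 < d by rewrite divr_gt0 // subr_gt0.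
have [j j2 hj] := archi_pow4 (8 * q)%:R d0.
have [L [iota [tau ht]]] := tower_exists C j.+1 hodd.
have hL := tower_card ht.
pose P := (q ^ (2 ^ j))%N.
have hLP : #|L| = (P ^ 2)%N by rewrite hL -expnM -expnSr.
have Podd : odd P by rewrite oddX hodd orbT.
pose r := P./2.
have hr : P = r.*2.+1 by rewrite /r -[LHS]odd_double_half Podd.
have hq3 : (3 <= q)%N by have hoddq : odd q := hodd; case: (q) q1 hoddq => [|[|[|]]].
have hP4 : (4 * q + 1 <= P)%N.
  have : (q ^ 4 <= P)%N by rewrite leq_exp2l // (leq_pexp2l (isT : 0 < 2)%N j2).
  apply: leq_trans; rewrite expnS.
  have : (3 ^ 3 <= q ^ 3)%N by rewrite leq_exp2r.
  by nia.
(* f = (X^q - X)^2 - 4 b has degree 2 q, which [stepanov] needs to be at most r;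
   this is why j is taken to be at least 2 *)
have hr2 : (2 * q <= r)%N by lia.
have ib0 : 4%:R * iota b != 0.
  have h2 : (2%:R : L) != 0 by apply: odd_char_neq0; rewrite hL oddX hodd orbT.
  by rewrite mulf_neq0 ?fmorph_eq0 // (_ : 4%:R = 2%:R * 2%:R :> L) ?mulf_neq0 // -natrM.
have hlow := sum_sqroots_lower (etrans hLP (congr1 (fun n => n ^ 2)%N hr)) hr2 (natr_card_base iota) q1 ib0.
have hiota : iota b != 0 by rewrite fmorph_eq0.
have := sum_kloosterman_tower ht hodd hpsi hiota.
set N := (\sum_(y : L) _)%N in hlow *.
rewrite (bigD1 0) //= => hsum.
pose s c := power_trace q (- k c) j.+1.
have hs c : c != 0 -> kloosterman (fun x => psi (c * tau x)) (iota b) = - (s c)%:C.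
  move=> c0; have := tower_kloosterman ht (hpsic c c0) b0 => ->.
  by rewrite hk // -(rmorphN (real_complex R)) rmorph_power_trace.
have h0 : kloosterman (fun x => psi (0 * tau x)) (iota b) = (#|L|%:R - 1)%:C.
  rewrite /kloosterman; under eq_bigr do rewrite mul0r (char0 (proj1 hpsi)).
  by rewrite sumr_const rmorphB rmorph1 rmorph_nat -card_nonzero -addn1 natrD addrK.
have hR : \sum_(c | c != 0) s c = #|L|%:R - 1 - N%:R.
  apply: (@complexI R); rewrite rmorphB rmorph_nat -hsum h0 rmorph_sum.
  under [X in _ - (_ + X)]eq_bigr => c c0 do rewrite hs //.
  by rewrite opprD addrA subrr add0r sumrN opprK.
have hle : \sum_(c | c != 0) (s c + (2 * P)%:R) <= (8 * q * P)%:R.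
  rewrite big_split /= hR sumr_const.
  have -> : #|[pred c : F | c != 0]| = q.-1 by rewrite /q -card_nonzero.
  have : (#|L|%:R : R) <= (N + 1 + 6 * q * P)%:R by rewrite ler_nat [P]hr.
  rewrite 2!natrD.
  have -> : (2 * P)%:R *+ q.-1 = (q.-1 * (2 * P))%:R :> R by rewrite -mulr_natl -natrM.
  have : ((q.-1 * (2 * P))%:R : R) <= (2 * q * P)%:R.
    by rewrite ler_nat mulnA (mulnC 2) leq_mul2r leq_mul2r leq_pred !orbT.
  have -> : (8 * q * P = 6 * q * P + 2 * q * P)%N by ring.
  rewrite natrD; lra.
have hge : 4%:R ^+ j * d * P%:R <= \sum_(c | c != 0) (s c + (2 * P)%:R).
  rewrite (bigD1 1) ?oner_neq0 //=.
  have hg : (2%:R + d) * q%:R <= (- k 1) ^+ 2 - (2 * q)%:R.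
    by rewrite sqrrN mulrDl /d divfK ?gt_eqF // !natrM; lra.
  have := power_trace_growth j (ltW d0) hg; rewrite -/(s 1) -/P.
  have : 0 <= \sum_(c | (c != 0) && (c != 1)) (s c + (2 * P)%:R).
    apply: sumr_ge0 => c _; rewrite -[X in _ + X]opprK subr_ge0; exact: power_trace_ge.
  have : 0 <= (P%:R : R) by rewrite ler0n.
  rewrite natrM; lra.
have := le_trans hge hle; rewrite natrM ler_pM2r ?ltr0n ?expn_gt0 ?(ltnW q1) // leNgt hj.
by [].
Qed.
End Weil.

(** * Gauss and Salie sums *)

Section GaussSalie.
Variables (C : numClosedFieldType) (F : finFieldType) (hodd : odd #|F|).
Let q := #|F|.

(** The quadratic character, extended by 0 at 0; this encoding makes sums over
    squares immediate. *)
Definition eta (v : F) : C := (sqroots v)%:R - 1.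

Lemma two_sub1 : 2%:R - 1 = 1 :> C. Proof. by ring. Qed.

Lemma eta0 : eta 0 = 0.
Proof. by rewrite /eta sqroots0 subrr. Qed.

Lemma eta_half v : v != 0 -> eta v = if v ^+ half_card F == 1 then 1 else -1.
Proof.
by move=> v0; rewrite /eta sqroots_half //; case: ifP => _; rewrite ?sub0r // two_sub1.
Qed.

Lemma etaM u v : eta (u * v) = eta u * eta v.
Proof.
have [->|u0] := eqVneq u 0; first by rewrite mul0r eta0 mul0r.
have [->|v0] := eqVneq v 0; first by rewrite mulr0 eta0 mulr0.
have m1 : (-1 : F) == 1 = false.
  by apply/negbTE; rewrite -subr_eq0 -opprD oppr_eq0 -mulr2n odd_char_neq0.
rewrite !eta_half ?mulf_neq0 // exprMn.
by case/orP: (expf_card_half hodd u0) => /eqP ->; case/orP: (expf_card_half hodd v0) => /eqP ->;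
  rewrite ?(mul1r, mulr1, mulN1r, opprK, eqxx, m1).
Qed.

Lemma eta_sqr v : v != 0 -> eta v * eta v = 1.
Proof. by move=> v0; rewrite eta_half //; case: ifP; rewrite ?mulrNN mulr1. Qed.

Lemma eta_square v : v != 0 -> eta (v ^+ 2) = 1.
Proof. by move=> v0; rewrite expr2 etaM eta_sqr. Qed.

Lemma eta1 : eta 1 = 1.
Proof. by rewrite -[1](expr1n _ 2) eta_square ?oner_neq0. Qed.

Lemma norm_eta_le v : `|eta v| <= 1.
Proof.
have [->|v0] := eqVneq v 0; first by rewrite eta0 normr0.
by rewrite eta_half //; case: ifP; rewrite ?normrN normr1.
Qed.

Lemma etaV v : eta v^-1 = eta v.
Proof.
have [->|v0] := eqVneq v 0; first by rewrite invr0.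
by rewrite -[RHS]mulr1 -(eta_sqr (v := v^-1)) ?invr_eq0 // mulrA -etaM divff // eta1 mul1r.
Qed.

Variables (psi : F -> C) (hpsi : nontrivial_char psi).
Let hchar : add_char psi := proj1 hpsi.
Let hnt : exists x, psi x != 1 := proj2 hpsi.

Lemma sum_sqr (g : F -> C) : \sum_x g (x ^+ 2) = \sum_v (sqroots v)%:R * g v.
Proof.
rewrite (partition_big (fun x : F => x ^+ 2) predT) //=; apply: eq_bigr => v _.
rewrite /sqroots mulr_natl -sumr_const; apply: eq_big => x; rewrite ?inE //.
by move/eqP => ->.
Qed.

Definition gauss_sum : C := \sum_v eta v * psi v.

Lemma gauss_sum_scale a : a != 0 -> \sum_v eta v * psi (a * v) = eta a * gauss_sum.
Proof.
move=> a0; rewrite /gauss_sum [in RHS](reindex_inj (mulfI a0)) /= mulr_sumr.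
by apply: eq_bigr => v _; rewrite etaM !mulrA eta_sqr // mul1r.
Qed.

Lemma gauss_sum_sqr a : a != 0 -> \sum_x psi (a * x ^+ 2) = eta a * gauss_sum.
Proof.
move=> a0; rewrite -gauss_sum_scale // (sum_sqr (fun v => psi (a * v))).
have h : \sum_v psi (a * v) = 0 by rewrite sum_char_scale // (negbTE a0).
rewrite -[RHS]addr0 -[X in _ = _ + X]h -big_split /=.
by apply: eq_bigr => v _; rewrite /eta mulrBl mul1r subrK.
Qed.

Lemma gauss_sum_norm : `|gauss_sum| ^+ 2 = q%:R.
Proof.
have e : gauss_sum = \sum_x psi (x ^+ 2).
  have := gauss_sum_sqr (oner_neq0 _).
  rewrite eta1 mul1r => <-.
  by apply: eq_bigr => x _; rewrite mul1r.
rewrite normCK e rmorph_sum mulr_suml.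
transitivity (\sum_(x : F) \sum_(h : F) psi (- h ^+ 2) * psi ((- 2%:R * h) * x)).
  apply: eq_bigr => x _; rewrite mulr_sumr (reindex_inj (addrI x)) /=.
  by apply: eq_bigr => h _; rewrite -charN // -!charD //; congr psi; ring.
rewrite exchange_big /=; under eq_bigr do rewrite -mulr_sumr sum_char_scale //.
rewrite (bigD1 0) //= big1 => [|h h0].
  by rewrite mulr0 eqxx expr0n oppr0 char0 // mul1r addr0.
by rewrite mulf_eq0 oppr_eq0 (negbTE (odd_char_neq0 hodd)) (negbTE h0) mulr0.
Qed.

Lemma gauss_quadratic s m : s != 0 ->
  \sum_x psi (s * x ^+ 2 + m * x) = psi (- (m ^+ 2 / (4%:R * s))) * (eta s * gauss_sum).
Proof.
move=> s0; rewrite -gauss_sum_sqr // mulr_sumr.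
have h2 := odd_char_neq0 hodd.
have h4 : (4%:R : F) != 0 by rewrite (_ : 4%:R = 2%:R * 2%:R :> F) ?mulf_neq0 // -natrM.
rewrite (reindex_inj (addIr (- (m / (2%:R * s))))) /=; apply: eq_bigr => x _.
by rewrite -charD //; congr psi; field; rewrite s0 h2 h4.
Qed.

(** From x (u - x) = c^2 one gets x (u + 2 c) = (x + c)^2, so eta is constant on
    the fibre, equal to eta (u + 2 c); the fibre has
    1 + eta (u + 2 c) eta (u - 2 c) elements. *)
Lemma salie_fiber (u c : F) : c != 0 -> u + 2%:R * c != 0 ->
  \sum_(x | x * (u - x) == c ^+ 2) eta x = eta (u + 2%:R * c) + eta (u - 2%:R * c).
Proof.
move=> c0 uc.
transitivity (\sum_(x | x * (u - x) == c ^+ 2) eta (u + 2%:R * c)).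
  apply: eq_bigr => x /eqP hx.
  have x0 : x != 0.
    by apply/eqP => x0; move/eqP: hx; rewrite x0 mul0r eq_sym expf_eq0 (negbTE c0).
  have e : x * (u + 2%:R * c) = (x + c) ^+ 2 by rewrite sqrrD -hx; ring.
  have xc : x + c != 0.
    by have := mulf_neq0 x0 uc; rewrite e sqrf_eq0.
  by rewrite -[RHS]mul1r -(eta_sqr x0) -mulrA -etaM e eta_square // mulr1.
rewrite sumr_const -[LHS]mulr_natr.
have -> : #|[pred x | x * (u - x) == c ^+ 2]| = sqroots ((u + 2%:R * c) * (u - 2%:R * c)).
  rewrite (_ : _ * _ = u ^+ 2 - 4%:R * c ^+ 2); last by ring.
  by rewrite -(card_sum_prod hodd); apply: eq_card => x; rewrite !inE.
have -> : (sqroots ((u + 2%:R * c) * (u - 2%:R * c)))%:R = eta (u + 2%:R * c) * eta (u - 2%:R * c) + 1.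
  by rewrite -etaM /eta subrK.
by rewrite mulrDr mulrA eta_sqr // mul1r mulr1 addrC.
Qed.

(** Group the terms by u = x + c^2/x.  The fibre formula is symmetric under
    c -> - c, and u + 2 c and u - 2 c are not both zero. *)
Lemma salie_eq (c : F) : c != 0 ->
  \sum_(x | x != 0) eta x * psi (x + c ^+ 2 / x) =
  gauss_sum * (psi (- (2%:R * c)) + psi (2%:R * c)).
Proof.
move=> c0.
transitivity (\sum_u psi u * \sum_(x | x * (u - x) == c ^+ 2) eta x).
  rewrite (partition_big (fun x => x + c ^+ 2 / x) predT) //=.
  apply: eq_bigr => u _; rewrite mulr_sumr; apply: eq_big => [x|x].
    have [->|x0] /= := eqVneq x 0; first by rewrite mul0r eq_sym sqrf_eq0 (negbTE c0).
    apply/eqP/eqP => [<-|<-]; last by field.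
    by rewrite addrAC subrr add0r mulrC divfK.
  by case/andP => _ /eqP ->; rewrite mulrC.
have shift a : \sum_u psi u * eta (u + a) = gauss_sum * psi (- a).
  rewrite /gauss_sum mulr_suml [RHS](reindex_inj (addIr a)) /=.
  apply: eq_bigr => u _; rewrite (charD hchar u a) -!mulrA -(charD hchar) subrr char0 // mulr1.
  by rewrite mulrC.
rewrite mulrDr -{2}[2%:R * c]opprK -!shift -big_split /=.
apply: eq_bigr => u _; rewrite -mulrDr; congr (_ * _).
have [uc|uc] := eqVneq (u + 2%:R * c) 0; last exact: salie_fiber.
have nc0 : - c != 0 by rewrite oppr_eq0.
have uc' : u + 2%:R * - c != 0.
  have -> : u + 2%:R * - c = - (2%:R * 2%:R * c) by rewrite -[LHS]subr0 -uc; ring.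
  by rewrite oppr_eq0 !mulf_neq0 ?odd_char_neq0.
have := salie_fiber nc0 uc'; rewrite sqrrN mulrN opprK => ->; exact: addrC.
Qed.

(** If b is not a square, the substitution x -> b/x changes the sign of the sum. *)
Lemma salie_bound (b : F) : b != 0 ->
  `|\sum_(x | x != 0) eta x * psi (x + b / x)| ^+ 2 <= (4 * q)%:R.
Proof.
move=> b0; have [hb|hb] := boolP (b ^+ half_card F == 1).
  have : sqroots b = 2%N by rewrite sqroots_half // hb.
  rewrite /sqroots; case: (set_0Vmem [set y : F | y ^+ 2 == b]) => [->|[c]].
    by rewrite cards0.
  rewrite inE => /eqP hc _; rewrite -hc salie_eq; last first.
    by apply: contra_neq b0 => c0; rewrite -hc c0 expr0n.
  rewrite normrM exprMn gauss_sum_norm natrM mulrC ler_wpM2r ?ler0n //.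
  have : `|psi (- (2%:R * c)) + psi (2%:R * c)| <= 2%:R.
    by apply: le_trans (ler_normD _ _) _; rewrite !(norm_char hchar).
  rewrite (_ : 4%:R = 2%:R ^+ 2 :> C); last by rewrite -natrX.
  by apply: lerXn2r; rewrite nnegrE ?normr_ge0 ?ler0n.
set S := \sum_(x | x != 0) eta x * psi (x + b / x).
have hS : S = - S.
  rewrite {1}/S (reindex_inj (h := fun x => b / x)) /=; last first.
    by move=> x y /(mulfI b0) /invr_inj.
  rewrite -sumrN; apply: eq_big => x; first by rewrite mulf_eq0 invr_eq0 (negbTE b0).
  rewrite mulf_eq0 invr_eq0 (negbTE b0) /= => x0.
  rewrite etaM etaV (eta_half b0) (negbTE hb) mulN1r mulNr; congr (- (_ * psi _)).
  by field; rewrite b0 x0.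
have -> : S = 0.
  move/eqP: hS; rewrite -subr_eq0 opprK -mulr2n -mulr_natl mulf_eq0 pnatr_eq0 /=.
  by move/eqP.
by rewrite normr0 expr0n ler0n.
Qed.
End GaussSalie.

(** * The Fourier transform of a sphere *)

Lemma sum_rV_prod (A : comNzSemiRingType) (T : finType) (d : nat) (h : 'I_d -> T -> A) :
  \sum_(x : 'rV[T]_d) \prod_i h i (x 0 i) = \prod_i \sum_a h i a.
Proof.
rewrite bigA_distr_bigA /= (reindex (fun f : {ffun 'I_d -> T} => \row_i f i)) /=.
  by apply: eq_bigr => f _; apply: eq_bigr => i _; rewrite mxE.
exists (fun x : 'rV[T]_d => [ffun i => x 0 i]) => x _.
  by apply/ffunP => i; rewrite ffunE mxE.
by apply/rowP => i; rewrite mxE ffunE.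
Qed.

Section Fourier.
Variables (C : numClosedFieldType) (F : finFieldType) (d : nat).
Variables (psi : F -> C) (hpsi : nontrivial_char psi).
Local Notation V := 'rV[F]_d.
Let q := #|F|.
Let hchar : add_char psi := proj1 hpsi.
Let hnt : exists x, psi x != 1 := proj2 hpsi.

Definition dotv (m x : V) : F := \sum_i m 0 i * x 0 i.

Lemma dotvD m x y : dotv m (x + y) = dotv m x + dotv m y.
Proof. by rewrite /dotv -big_split; apply: eq_bigr => i _; rewrite mxE mulrDr. Qed.

Lemma dotvN m x : dotv m (- x) = - dotv m x.
Proof. by rewrite /dotv -sumrN; apply: eq_bigr => i _; rewrite mxE mulrN. Qed.

Lemma sum_char_dotv (x : V) : \sum_m psi (dotv m x) = if x == 0 then (q ^ d)%:R else 0.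
Proof.
under eq_bigr do rewrite char_sum //.
rewrite (sum_rV_prod (fun i a => psi (a * x 0 i))).
under eq_bigr do under eq_bigr do rewrite mulrC.
under eq_bigr do rewrite sum_char_scale //.
case: eqP => [->|/eqP /rV0Pn [i xi]].
  by under eq_bigr do rewrite mxE eqxx; rewrite prodr_const card_ord natrX.
by rewrite (bigD1 i) //= (negbTE xi) mul0r.
Qed.

Definition fourier (g : V -> C) (m : V) : C := \sum_x g x * psi (dotv m x).

Lemma parseval (g : V -> C) :
  \sum_m `|fourier g m| ^+ 2 = (q ^ d)%:R * \sum_x `|g x| ^+ 2.
Proof.
transitivity (\sum_m \sum_x \sum_y g x * (g y)^* * psi (dotv m (x - y))).
  apply: eq_bigr => m _; rewrite normCK /fourier rmorph_sum mulr_suml.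
  apply: eq_bigr => x _; rewrite mulr_sumr; apply: eq_bigr => y _.
  by rewrite rmorphM /= -(charN hchar) dotvD dotvN (charD hchar) mulrACA.
rewrite exchange_big mulr_sumr /=; apply: eq_bigr => x _.
rewrite exchange_big (bigD1 x) //= [X in _ + X]big1 => [|y yx].
  by rewrite -mulr_sumr sum_char_dotv subrr eqxx addr0 normCK mulrC.
by rewrite -mulr_sumr sum_char_dotv subr_eq0 eq_sym (negbTE yx) mulr0.
Qed.

Definition conv (K g : V -> C) (x : V) : C := \sum_y K (x - y) * g y.

Lemma fourier_conv K g m : fourier (conv K g) m = fourier K m * fourier g m.
Proof.
rewrite /fourier /conv; under eq_bigr do rewrite mulr_suml.
rewrite exchange_big mulr_sumr /=; apply: eq_bigr => y _.
rewrite (reindex_inj (addIr y)) mulr_suml /=; apply: eq_bigr => x _.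
by rewrite addrK dotvD charD // mulrACA.
Qed.

Lemma conv_l2 (K g : V -> C) (B : C) : (forall m, `|fourier K m| ^+ 2 <= B) ->
  \sum_x `|conv K g x| ^+ 2 <= B * \sum_x `|g x| ^+ 2.
Proof.
move=> hB; have q0 : 0 < ((q ^ d)%:R : C).
  by rewrite ltr0n expn_gt0 (ltnW (finNzRing_gt1 F)).
rewrite -(ler_pM2l q0) -parseval mulrCA -parseval mulr_sumr; apply: ler_sum => m _.
by rewrite fourier_conv normrM exprMn ler_wpM2r // exprn_ge0.
Qed.

Hypothesis hodd : odd q.

(** The weight 1/q is the one that produces the main term |E|^(k+1)/q^k.  It
    is not the exact density of the sphere, so the Fourier coefficient at 0 need
    not vanish and is bounded along with the others. *)
Definition sphere_kernel (t : F) (z : V) : C := (sqnorm z == t)%:R - q%:R^-1.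

Lemma sphere_kernelE t z :
  sphere_kernel t z = q%:R^-1 * \sum_(s | s != 0) psi (s * (sqnorm z - t)).
Proof.
have q0 : (q%:R : C) != 0 by rewrite pnatr_eq0 -lt0n ltnW ?finNzRing_gt1.
have h : \sum_s psi (s * (sqnorm z - t)) = if sqnorm z == t then q%:R else 0.
  by under eq_bigr do rewrite mulrC; rewrite sum_char_scale // subr_eq0.
have -> : \sum_(s | s != 0) psi (s * (sqnorm z - t)) = (if sqnorm z == t then q%:R else 0) - 1.
  by rewrite -h [in RHS](bigD1 0) //= mul0r char0 // addrAC subrr add0r.
rewrite /sphere_kernel mulrBr mulr1; congr (_ - _).
by case: eqP; rewrite ?mulr0 // mulVf.
Qed.

Lemma fourier_sphere_kernel t m : fourier (sphere_kernel t) m =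
  q%:R^-1 * gauss_sum psi ^+ d *
    \sum_(s | s != 0) eta C s ^+ d * psi (- t * s + - (sqnorm m / 4%:R) / s).
Proof.
rewrite /fourier; under eq_bigr do rewrite sphere_kernelE -mulrA mulr_suml.
rewrite -mulr_sumr -mulrA; congr (_ * _).
rewrite exchange_big mulr_sumr /=; apply: eq_bigr => s s0.
have h4 : (4%:R : F) != 0.
  by rewrite (_ : 4%:R = 2%:R * 2%:R :> F) ?mulf_neq0 ?odd_char_neq0 // -natrM.
transitivity (psi (- t * s) * \sum_(x : V) \prod_i psi (s * x 0 i ^+ 2 + m 0 i * x 0 i)).
  rewrite mulr_sumr; apply: eq_bigr => x _.
  rewrite -(char_sum hchar) -!charD //; congr psi.
  by rewrite big_split /= -mulr_sumr -/(dotv m x) -/(sqnorm x); ring.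
rewrite (sum_rV_prod (fun i a => psi (s * a ^+ 2 + m 0 i * a))).
under [X in _ * X]eq_bigr do rewrite gauss_quadratic //.
rewrite big_split /= prodr_const card_ord -(char_sum hchar) exprMn (charD hchar).
have -> : \sum_(i < d) - (m 0 i ^+ 2 / (4%:R * s)) = - (sqnorm m / 4%:R) / s.
  by rewrite sumrN -mulr_suml -/(sqnorm m); field; rewrite h4 s0.
by move: (gauss_sum psi ^+ d) (eta C s ^+ d) (psi _) (psi _) => A B X Y; ring.
Qed.
End Fourier.

Section Bound.
Variables (R : realType) (F : finFieldType) (d : nat) (hodd : odd #|F|).
Local Notation C := R[i].
Local Notation V := 'rV[F]_d.
Variables (psi : F -> C) (hpsi : nontrivial_char psi).
Let q := #|F|.

(** For odd d the factor eta^d is eta and the sum is a Salie sum, or a Gauss sum if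
    b = 0; for even d it is a Kloosterman sum, or -1 if b = 0. *)
Lemma twisted_kloosterman_bound (a b : F) : a != 0 ->
  `|\sum_(s | s != 0) eta C s ^+ d * psi (a * s + b / s)| ^+ 2 <= (4 * q)%:R.
Proof.
move=> a0; have hchar := proj1 hpsi; have hnt := proj2 hpsi.
have q14 : (q%:R : C) <= (4 * q)%:R by rewrite ler_nat leq_pmull.
have red (g : F -> C) : \sum_(s | s != 0) g s * psi (a * s + b / s) =
   \sum_(s | s != 0) g (s / a) * psi (s + (a * b) / s).
  rewrite (reindex_inj (mulIf (invr_neq0 a0))) /=.
  apply: eq_big => s; first by rewrite mulf_eq0 invr_eq0 (negbTE a0) orbF.
  rewrite mulf_eq0 invr_eq0 (negbTE a0) orbF => s0; congr (_ * psi _).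
  by field; rewrite a0 s0.
rewrite red; have [dodd|deven] := boolP (odd d).
  have -> : \sum_(s | s != 0) eta C (s / a) ^+ d * psi (s + a * b / s) =
     eta C a * \sum_(s | s != 0) eta C s * psi (s + a * b / s).
    rewrite mulr_sumr; apply: eq_bigr => s s0.
    have sa : s / a != 0 by rewrite mulf_neq0 ?invr_eq0.
    rewrite -(odd_double_half d) dodd exprS -mul2n exprM [eta C _ ^+ 2]expr2 eta_sqr // expr1n mulr1.
    by rewrite etaM // etaV // mulrA (mulrC (eta C a)).
  rewrite normrM exprMn; set S := \sum_(s | _) _.
  suff hS : `|S| ^+ 2 <= (4 * q)%:R.
    by apply: le_trans hS; rewrite ler_piMl ?exprn_ge0 // exprn_ile1 // norm_eta_le.
  have [b0|b0] := eqVneq b 0; last by apply: salie_bound => //; rewrite mulf_neq0.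
  have -> : S = gauss_sum psi.
    rewrite /gauss_sum (bigD1 0) //= eta0 // mul0r add0r.
    by apply: eq_bigr => s _; rewrite b0 mulr0 mul0r addr0.
  by rewrite gauss_sum_norm.
have -> : \sum_(s | s != 0) eta C (s / a) ^+ d * psi (s + a * b / s) = kloosterman psi (a * b).
  apply: eq_bigr => s s0; have sa : s / a != 0 by rewrite mulf_neq0 ?invr_eq0.
  rewrite -(odd_double_half d) (negbTE deven) -mul2n exprM [eta C _ ^+ 2]expr2 eta_sqr //.
  by rewrite expr1n mul1r.
have [b0|b0] := eqVneq b 0.
  have -> : kloosterman psi (a * b) = -1.
    have := sum_char hchar hnt; rewrite (bigD1 0) //= char0 // => /eqP.
    rewrite addrC addr_eq0 => /eqP <-; apply: eq_bigr => s _.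
    by rewrite b0 mulr0 mul0r addr0.
  by rewrite normrN normr1 expr1n; apply: le_trans q14; rewrite ler1n ltnW ?finNzRing_gt1.
have ab0 : a * b != 0 by rewrite mulf_neq0.
rewrite real_normK; last exact: kloosterman_real.
exact: kloosterman_bound.
Qed.

Lemma fourier_sphere_kernel_bound (t : F) (m : V) : t != 0 ->
  `|fourier psi (sphere_kernel C t) m| ^+ 2 <= (4 * q ^ d)%:R / q%:R.
Proof.
move=> t0; rewrite (fourier_sphere_kernel hpsi hodd) // !normrM !exprMn normfV normr_nat normrX.
rewrite exprAC gauss_sum_norm // -/q.
have q0 : (0 : C) < q%:R by rewrite ltr0n ltnW ?finNzRing_gt1.
have -> : (4 * q ^ d)%:R / q%:R = q%:R^-1 ^+ 2 * q%:R ^+ d * (4 * q)%:R :> C.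
  by rewrite !natrM natrX; field; rewrite gt_eqF.
rewrite ler_wpM2l ?mulr_ge0 ?exprn_ge0 ?invr_ge0 ?ler0n //.
by apply: twisted_kloosterman_bound; rewrite oppr_eq0.
Qed.
End Bound.

(** The spectral gap: convolution with the kernel has l2-operator norm equal to
    its largest Fourier coefficient, here bounded by 2 q^((d-1)/2). *)
Lemma sphere_discrepancy (R : realType) (F : finFieldType) (d : nat) (t : F) (g : 'rV[F]_d -> R) :
  odd #|F| -> t != 0 ->
  \sum_x (\sum_y ((sqnorm (x - y) == t)%:R - #|F|%:R^-1) * g y) ^+ 2 <=
    (4 * #|F| ^ d)%:R / #|F|%:R * \sum_x g x ^+ 2.
Proof.
move=> hodd t0; have [psi hpsi] := nontrivial_char_exists R[i] F.
have := conv_l2 hpsi (fun x => (g x)%:C%C) (fun m => fourier_sphere_kernel_bound hodd hpsi m t0).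
have hc (x : R) : `|x%:C%C| ^+ 2 = (x ^+ 2)%:C%C.
  by rewrite real_normK ?rmorphXn // complex_real.
under eq_bigr => x _.
  have -> : conv (sphere_kernel R[i] t) (fun x => (g x)%:C%C) x =
    (\sum_y ((sqnorm (x - y) == t)%:R - #|F|%:R^-1) * g y)%:C%C.
    rewrite rmorph_sum; apply: eq_bigr => y _.
    by rewrite rmorphM rmorphB fmorphV !rmorph_nat.
  rewrite hc. over.
rewrite -rmorph_sum; under [X in (_ <= _ * X -> _)]eq_bigr do rewrite hc.
rewrite -rmorph_sum -!(rmorph_nat (real_complex R)) -fmorphV -!rmorphM lecR.
by [].
Qed.

(** * Counting chains by walks *)

Section L2.
Variables (R : rcfType) (T : finType).
Implicit Types u v : T -> R.

Definition l2norm u := Num.sqrt (\sum_x u x ^+ 2).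

Lemma sum_sqr_ge0 u : 0 <= \sum_x u x ^+ 2.
Proof. by apply: sumr_ge0 => x _; exact: sqr_ge0. Qed.

Lemma l2norm_ge0 u : 0 <= l2norm u. Proof. exact: sqrtr_ge0. Qed.

Lemma l2norm_sqr u : l2norm u ^+ 2 = \sum_x u x ^+ 2.
Proof. by rewrite sqr_sqrtr // sum_sqr_ge0. Qed.

Lemma cauchy_schwarz_sqr u v :
  (\sum_x u x * v x) ^+ 2 <= (\sum_x u x ^+ 2) * (\sum_x v x ^+ 2).
Proof.
set A := \sum_x u x ^+ 2; set B := \sum_x v x ^+ 2; set D := \sum_x _.
have A0 : 0 <= A := sum_sqr_ge0 u.
have key : 0 <= A * (A * B - D ^+ 2).
  have -> : A * (A * B - D ^+ 2) = \sum_x (A * v x - D * u x) ^+ 2.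
    transitivity (\sum_x (A ^+ 2 * v x ^+ 2 + - (2%:R * A * D) * (u x * v x) + D ^+ 2 * u x ^+ 2)).
      by rewrite !big_split -!mulr_sumr -/A -/B -/D /=; ring.
    by apply: eq_bigr => x _; ring.
  exact: sum_sqr_ge0.
have [A1|A1] := eqVneq A 0; last first.
  by rewrite -subr_ge0; move: key; rewrite pmulr_rge0 // lt_def A1.
have u0 x : u x = 0.
  have /psumr_eq0P h : \sum_x u x ^+ 2 = 0 by [].
  by apply/eqP; rewrite -sqrf_eq0 h // => y _; exact: sqr_ge0.
by rewrite A1 mul0r /D big1 ?expr0n // => x _; rewrite u0 mul0r.
Qed.

Lemma cauchy_schwarz u v : `|\sum_x u x * v x| <= l2norm u * l2norm v.
Proof.
rewrite -ler_sqr ?nnegrE ?normr_ge0 ?mulr_ge0 ?l2norm_ge0 //.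
by rewrite real_normK ?num_real // exprMn !l2norm_sqr cauchy_schwarz_sqr.
Qed.

Lemma l2norm_le u c : 0 <= c -> \sum_x u x ^+ 2 <= c ^+ 2 -> l2norm u <= c.
Proof. by move=> c0 h; rewrite -ler_sqr ?nnegrE ?l2norm_ge0 // l2norm_sqr. Qed.

Lemma l2normD u v : l2norm (fun x => u x + v x) <= l2norm u + l2norm v.
Proof.
apply: l2norm_le; first by rewrite addr_ge0 ?l2norm_ge0.
rewrite sqrrD !l2norm_sqr; under eq_bigr do rewrite sqrrD.
rewrite 2!big_split /= lerD2r lerD2l sumrMnl ler_pMn2r //.
exact: le_trans (ler_norm _) (cauchy_schwarz _ _).
Qed.

Lemma l2normZ c u : l2norm (fun x => c * u x) = `|c| * l2norm u.
Proof.
rewrite /l2norm -sqrtr_sqr -sqrtrM ?sqr_ge0 // mulr_sumr.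
by congr Num.sqrt; apply: eq_bigr => x _; rewrite exprMn.
Qed.

Lemma eq_l2norm u v : u =1 v -> l2norm u = l2norm v.
Proof. by move=> h; congr Num.sqrt; apply: eq_bigr => x _; rewrite h. Qed.

Lemma l2norm_mono u v : (forall x, `|u x| <= `|v x|) -> l2norm u <= l2norm v.
Proof.
move=> h; apply: l2norm_le; rewrite ?l2norm_ge0 // l2norm_sqr; apply: ler_sum => x _.
by rewrite -(real_normK (num_real (u x))) -(real_normK (num_real (v x))) lerXn2r ?nnegrE.
Qed.

End L2.

Lemma forall_ord_recl k (P : pred 'I_k.+1) :
  [forall i, P i] = P ord0 && [forall i : 'I_k, P (lift ord0 i)].
Proof.
apply/forallP/andP => [h|[h0 /forallP h] i]; first by split; [|apply/forallP => i].
by case: (unliftP ord0 i) => [j ->|->].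
Qed.

Section Walks.
Variables (R : realType) (F : finFieldType) (d : nat) (E : {set 'rV[F]_d}).
Local Notation V := 'rV[F]_d.

Definition ind (x : V) : R := (x \in E)%:R.

(** Chains in E with prescribed step lengths, counted from their first point. *)
Fixpoint walk (k : nat) : ('I_k -> F) -> V -> R :=
  match k with
  | 0 => fun _ x => ind x
  | k'.+1 => fun t x => ind x * \sum_y (sqnorm (x - y) == t ord0)%:R * walk (t \o lift ord0) y
  end.

Definition ffcons k (x : V) (c : {ffun 'I_k -> V}) : {ffun 'I_k.+1 -> V} :=
  [ffun i => if unlift ord0 i is Some j then c j else x].

Lemma chains_cons k (t : 'I_k.+1 -> F) x (c : {ffun 'I_k.+1 -> V}) :
  (ffcons x c \in chains E t) =
  [&& x \in E, sqnorm (x - c ord0) == t ord0 & c \in chains E (t \o lift ord0)].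
Proof.
have h0 : ffcons x c ord0 = x by rewrite ffunE unlift_none.
have hS i : ffcons x c (lift ord0 i) = c i by rewrite ffunE liftK.
have hW (i : 'I_k) : widen_ord (leqnSn k.+1) (lift ord0 i) = lift ord0 (widen_ord (leqnSn k) i).
  exact/val_inj.
rewrite !inE forall_ord_recl h0 [X in _ && X = _]forall_ord_recl.
rewrite (_ : widen_ord _ ord0 = ord0) ?h0 ?hS; last exact/val_inj.
under eq_forallb do rewrite hS.
under [X in _ && (_ && X) = _]eq_forallb do rewrite hW !hS.
by rewrite -!andbA; congr (_ && _); rewrite andbCA.
Qed.

Lemma sum_ffcons k (G : {ffun 'I_k.+1 -> V} -> R) :
  \sum_c G c = \sum_x \sum_(c : {ffun 'I_k -> V}) G (ffcons x c).
Proof.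
rewrite pair_big /= (reindex (fun p : V * {ffun 'I_k -> V} => ffcons p.1 p.2)) //=.
exists (fun c => (c ord0, [ffun i => c (lift ord0 i)])) => [[x c] _|c _] /=.
  congr (_, _); first by rewrite ffunE unlift_none.
  by apply/ffunP => i; rewrite !ffunE liftK.
by apply/ffunP => i; rewrite ffunE; case: unliftP => [j|] ->; rewrite ?ffunE.
Qed.

Lemma walk_count k (t : 'I_k -> F) x :
  \sum_(c : {ffun 'I_k.+1 -> V}) ((c ord0 == x) && (c \in chains E t))%:R = walk t x :> R.
Proof.
elim: k t x => [|k IH] t x.
  rewrite sum_ffcons exchange_big /=.
  rewrite (bigD1 [ffun i => x]) //= [X in _ + X]big1 ?addr0; last first.
    by move=> c /eqP h; case: h; apply/ffunP => -[].
  rewrite (bigD1 x) //= big1 ?addr0 => [|y yx]; last by rewrite ffunE unlift_none (negbTE yx).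
  rewrite ffunE unlift_none eqxx /= /ind inE; congr (_%:R); congr nat_of_bool.
  apply/andP/idP => [[/forallP/(_ ord0)]|hx]; first by rewrite ffunE unlift_none.
  split; apply/forallP => i; last by case: i.
  by rewrite ffunE; case: unliftP => [j|_]; [case: j|].
rewrite sum_ffcons (bigD1 x) //= [X in _ + X]big1 ?addr0; last first.
  by move=> y yx; apply: big1 => c _; rewrite ffunE unlift_none (negbTE yx).
rewrite mulr_sumr; under [RHS]eq_bigr do rewrite -IH !mulr_sumr.
rewrite exchange_big /=; apply: eq_bigr => c _.
rewrite (bigD1 (c ord0)) //= [X in _ = _ + X]big1 ?addr0; last first.
  by move=> y yc; rewrite (eq_sym (c ord0)) (negbTE yc) /= !mulr0.
rewrite chains_cons ffunE unlift_none !eqxx /= /ind.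
by case: (x \in E); case: (_ == _); case: (_ \in _); rewrite ?mulr0 ?mul0r ?mul1r.
Qed.

Lemma chain_count_walk k (t : 'I_k -> F) : (chain_count E t)%:R = \sum_x walk t x.
Proof.
under eq_bigr do rewrite -walk_count.
rewrite exchange_big /= /chain_count -sumr_const.
rewrite big_mkcond /=; apply: eq_bigr => c _.
rewrite (bigD1 (c ord0)) //= eqxx big1 ?addr0 => [|x xc]; last by rewrite (eq_sym (c ord0)) (negbTE xc).
by case: ifP.
Qed.
End Walks.

Section WalkEstimate.
Variables (R : realType) (F : finFieldType) (d : nat) (E : {set 'rV[F]_d}).
Hypothesis hodd : odd #|F|.
Local Notation V := 'rV[F]_d.
Let q : R := #|F|%:R.
Let n : R := #|E|%:R.
Let mu := n / q.
(** This is 2 q^((d-1)/2), in a form that avoids the predecessor of d. *)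
Definition sphere_gap : R := Num.sqrt ((4 * #|F| ^ d)%:R / #|F|%:R).
Local Notation ind := (ind R E).
Local Notation walk := (walk R E).

Lemma natr_card_gt0 : 0 < q.
Proof. by rewrite ltr0n; apply/card_gt0P; exists 0. Qed.

Lemma sphere_gap_ge0 : 0 <= sphere_gap. Proof. exact: sqrtr_ge0. Qed.

Lemma sum_ind : \sum_x ind x = n.
Proof. by rewrite /ind /n -sumr_const [RHS]big_mkcond; apply: eq_bigr => x _; case: (x \in E). Qed.

Lemma ind_sqr x : ind x * ind x = ind x.
Proof. by rewrite /ind; case: (x \in E); rewrite ?mulr0 ?mulr1. Qed.

Lemma l2norm_ind : l2norm ind = Num.sqrt n.
Proof. by congr Num.sqrt; rewrite -sum_ind; apply: eq_bigr => x _; rewrite expr2 ind_sqr. Qed.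

Lemma mu_ge0 : 0 <= mu. Proof. by rewrite divr_ge0 ?ler0n. Qed.

Lemma ind_walk k (t : 'I_k -> F) x : ind x * walk t x = walk t x.
Proof. by case: k t => [|k] t /=; rewrite ?mulrA ind_sqr. Qed.

Lemma sum_supported (h : V -> R) : (forall x, ind x * h x = h x) ->
  `|\sum_x h x| <= Num.sqrt n * l2norm h.
Proof.
move=> hh; under eq_bigr do rewrite -hh.
by rewrite -l2norm_ind; exact: cauchy_schwarz.
Qed.

Lemma l2norm_sphere (t : F) (g : V -> R) : t != 0 ->
  l2norm (fun x => \sum_y ((sqnorm (x - y) == t)%:R - q^-1) * g y) <= sphere_gap * l2norm g.
Proof.
move=> t0; apply: l2norm_le; first by rewrite mulr_ge0 ?sphere_gap_ge0 ?l2norm_ge0.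
rewrite exprMn l2norm_sqr sqr_sqrtr; first exact: sphere_discrepancy.
by rewrite divr_ge0 ?ler0n.
Qed.

(** Let h be the deviation after k steps.  One more step splits the deviation into
    the mean of h, spread over E, of norm at most mu |h|, and the discrepancy
    operator applied to the whole walk function, of norm at most
    [sphere_gap] * sqrt |E| (mu + sphere_gap)^k. *)
Lemma walk_deviation k (t : 'I_k -> F) : (forall i, t i != 0) ->
  l2norm (fun x => walk t x - mu ^+ k * ind x) <= Num.sqrt n * ((mu + sphere_gap) ^+ k - mu ^+ k).
Proof.
elim: k t => [|k IH] t ht.
  rewrite !expr0 subrr mulr0; apply: l2norm_le => //.
  by rewrite expr0n big1 // => x _; rewrite mul1r subrr expr0n.
set t' := t \o lift ord0; set h := fun x => walk t' x - mu ^+ k * ind x.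
have hh : l2norm h <= Num.sqrt n * ((mu + sphere_gap) ^+ k - mu ^+ k) by apply: IH => i; exact: ht.
have hsupp x : ind x * h x = h x by rewrite /h mulrBr ind_walk mulrCA ind_sqr.
pose N x := \sum_y ((sqnorm (x - y) == t ord0)%:R - q^-1) * walk t' y.
have hN : l2norm N <= sphere_gap * (Num.sqrt n * (mu + sphere_gap) ^+ k).
  apply: le_trans (l2norm_sphere _ (ht ord0)) _; apply: ler_wpM2l; first exact: sphere_gap_ge0.
  rewrite (eq_l2norm (v := fun x => mu ^+ k * ind x + h x)); last by move=> x; rewrite /h addrC subrK.
  apply: le_trans (l2normD _ _) _.
  rewrite l2normZ l2norm_ind ger0_norm ?exprn_ge0 ?mu_ge0 //.
  by apply: le_trans (lerD (lexx _) hh) _; rewrite (mulrC (mu ^+ k)) -mulrDr subrKC.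
have q0 := natr_card_gt0.
rewrite (eq_l2norm (v := fun x => (\sum_y h y) / q * ind x + ind x * N x)); last first.
  move=> x /=; rewrite -/t'.
  have -> : N x = \sum_y (sqnorm (x - y) == t ord0)%:R * walk t' y - q^-1 * \sum_y walk t' y.
    by rewrite /N mulr_sumr -sumrB; apply: eq_bigr => y _; rewrite mulrBl.
  have -> : \sum_y h y = \sum_y walk t' y - mu ^+ k * n by rewrite sumrB -mulr_sumr sum_ind.
  by rewrite exprSr /mu -/mu {2}/mu; ring.
apply: le_trans (l2normD _ _) _.
have h1 : l2norm (fun x => ind x * N x) <= sphere_gap * (Num.sqrt n * (mu + sphere_gap) ^+ k).
  apply: le_trans hN; apply: l2norm_mono => x; rewrite normrM /ind.
  by case: (x \in E); rewrite ?normr1 ?mul1r // normr0 mul0r.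
have h2 : l2norm (fun x => (\sum_y h y) / q * ind x) <= mu * (Num.sqrt n * ((mu + sphere_gap) ^+ k - mu ^+ k)).
  rewrite l2normZ l2norm_ind normrM (gtr0_norm (x := q^-1)) ?invr_gt0 //.
  apply: (@le_trans _ _ (mu * l2norm h)); last by rewrite ler_wpM2l ?mu_ge0.
  have -> : mu * l2norm h = Num.sqrt n * l2norm h / q * Num.sqrt n.
    by rewrite /mu -[in LHS](sqr_sqrtr (ler0n R #|E| : 0 <= n)); ring.
  by rewrite ler_wpM2r ?sqrtr_ge0 // ler_wpM2r ?invr_ge0 ?(ltW q0) // sum_supported.
apply: le_trans (lerD h2 h1) _; rewrite !exprS le_eqVlt; apply/orP; left; apply/eqP; ring.
Qed.

Lemma chain_count_deviation k (t : 'I_k -> F) : (forall i, t i != 0) ->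
  `|(chain_count E t)%:R - n * mu ^+ k| <= n * ((mu + sphere_gap) ^+ k - mu ^+ k).
Proof.
move=> ht; have -> : (chain_count E t)%:R - n * mu ^+ k = \sum_x (walk t x - mu ^+ k * ind x).
  by rewrite sumrB -mulr_sumr sum_ind (chain_count_walk R) mulrC.
have hsupp x : ind x * (walk t x - mu ^+ k * ind x) = walk t x - mu ^+ k * ind x.
  by rewrite mulrBr ind_walk mulrCA ind_sqr.
apply: le_trans (sum_supported hsupp) _.
rewrite -[X in _ <= X * _](sqr_sqrtr (ler0n R #|E| : 0 <= n)) expr2 -mulrA.
by rewrite ler_wpM2l ?sqrtr_ge0 // walk_deviation.
Qed.

End WalkEstimate.

(** Convexity of the exponential between 0, where it is 1, and ln 2, where it
    is 2. *)
Lemma expR_le_chord (R : realType) (y : R) : 0 <= y <= ln 2 -> expR y <= 1 + y / ln 2.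
Proof.
case/andP => y0 y2; have l0 : 0 < ln 2 :> R by rewrite ln_gt0 // ltr1n.
have s0 : 0 <= y / ln 2 by rewrite divr_ge0 // ltW.
have s1 : y / ln 2 <= 1 by rewrite ler_pdivrMr // mul1r.
have := convex_expR (Itv01 s0 s1) (ln 2 : R^o) (0 : R^o).
rewrite !convRE /= /onem mulr0 addr0 expR0 mulr1 divfK ?gt_eqF // lnK ?posrE //.
lra.
Qed.

Lemma binomial_growth_le (R : realType) (k : nat) (x : R) : 0 <= x -> k%:R * x <= ln 2 ->
  (1 + x) ^+ k - 1 <= k%:R * x / ln 2.
Proof.
move=> x0 hx; rewrite lerBlDl.
have h : (1 + x) ^+ k <= expR (k%:R * x).
  by rewrite expRM_natl lerXn2r ?nnegrE ?addr_ge0 ?expR_ge0 ?expR_ge1Dx.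
by apply: le_trans h (expR_le_chord _); rewrite hx mulr_ge0 ?ler0n.
Qed.

Theorem theorem1p1 (R : realType) (F : finFieldType) (hodd : odd #|F|)
    (d : nat) (hd : (2 <= d)%N) (k : nat) (hk : (1 <= k)%N)
    (E : {set 'rV[F]_d})
    (hE : (2 * k%:R) / ln 2 * (#|F|%:R : R) `^ (d.+1%:R / 2)
            < (#|E|%:R : R))
    (t : 'I_k -> F) (ht : forall i : 'I_k, t i != 0) :
  (exists D : R,
      ((chain_count E t)%:R : R)
        = #|E|%:R ^+ k.+1 / #|F|%:R ^+ k + D
      /\ `|D| <= (2 * k%:R) / ln 2 * (#|F|%:R : R) `^ (d.+1%:R / 2)
                   * (#|E|%:R ^+ k / #|F|%:R ^+ k))
  /\ (0 < chain_count E t)%N.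
Proof.
set q : R := #|F|%:R in hE *; set n : R := #|E|%:R in hE *; set S := q `^ _ in hE *.
have q0 : 0 < q := natr_card_gt0 R F.
have S0 : 0 <= S by exact: powR_ge0.
have l0 : 0 < ln 2 :> R by rewrite ln_gt0 // ltr1n.
have n0 : 0 < n.
  by apply: le_lt_trans hE; rewrite mulr_ge0 // divr_ge0 ?mulr_ge0 ?ler0n // ltW.
have mu0 : 0 < n / q by rewrite divr_gt0.
have hS : sphere_gap R F d * q = 2%:R * S.
  apply/eqP; rewrite -(@eqrXn2 _ 2) ?mulr_ge0 ?sphere_gap_ge0 ?(ltW q0) //.
  rewrite !exprMn sqr_sqrtr ?divr_ge0 ?ler0n // -/q natrM natrX -/q.
  have -> : S ^+ 2 = q ^+ d.+1.
    by rewrite -powR_mulrn // -powRrM divfK ?pnatr_eq0 // powR_mulrn // ltW.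
  by apply/eqP; rewrite [q ^+ d.+1]exprS; move: (q ^+ d) => A; field; rewrite gt_eqF.
set D := (chain_count E t)%:R - n * (n / q) ^+ k.
have eM : n ^+ k.+1 / q ^+ k = n * (n / q) ^+ k by rewrite exprS expr_div_n mulrA.
have hD : `|D| <= 2 * k%:R / ln 2 * S * (n ^+ k / q ^+ k).
  have := @chain_count_deviation R F d E hodd k t ht; rewrite -/q -/n -/D => /le_trans; apply.
  rewrite -expr_div_n.
  pose x := sphere_gap R F d / (n / q).
  have ex : sphere_gap R F d = n / q * x by rewrite /x mulrC divfK ?gt_eqF.
  have x0 : 0 <= x by rewrite divr_ge0 ?sphere_gap_ge0 ?(ltW mu0).
  have nx : n * x = 2%:R * S by rewrite -hS ex; field; rewrite gt_eqF.
  have kx : k%:R * x <= ln 2.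
    rewrite -(ler_pM2l n0) mulrCA nx; apply: ltW; move: hE.
    rewrite mulrAC ltr_pdivrMr // => hE'; apply: le_lt_trans hE'.
    by rewrite le_eqVlt; apply/orP; left; apply/eqP; ring.
  rewrite ex -[X in (X + _) ^+ k]mulr1 -mulrDr exprMn.
  rewrite -[X in _ - X]mulr1 -mulrBr mulrCA.
  apply: (@le_trans _ _ (n * ((n / q) ^+ k * (k%:R * x / ln 2)))).
    by rewrite mulrCA !ler_pM2l ?exprn_gt0 // binomial_growth_le.
  rewrite (_ : n * _ = (n * x) * (n / q) ^+ k * (k%:R / ln 2)); last by ring.
  by rewrite nx le_eqVlt; apply/orP; left; apply/eqP; ring.
split.
  by exists D; split; rewrite // eM /D subrKC.
rewrite -(ltr_nat R) mulr0n.
have : - D < n * (n / q) ^+ k.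
  apply: le_lt_trans (ler_norm _) _; rewrite normrN; apply: le_lt_trans hD _.
  by rewrite -expr_div_n ltr_pM2r // exprn_gt0.
by rewrite /D opprB ltrBlDr -ltrBlDl subrr.
Qed.
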